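(* Let $r\in\{1,4\}$ and let $n$ be a positive integer such that $d=n^2+r$ is square-free and $d\equiv 5\pmod 8$. Let $p$ be an odd prime divisor of $n$, and assume that $n\neq p$ if $r=4$, and that $n\neq 2p$ if $r=1$. If $h(d)=3$, then $$\sum_{\substack{ |t|<\sqrt{d}\\ t^2\equiv d \pmod 4}}\sigma\left(\frac{d-t^2}{4}\right)=\begin{cases} \dfrac{n^3+11n}{6}+ \dfrac{n^3+n(p^4+10p^2)}{3p^2}, & \text{if } r=4,\\[2mm] \dfrac{n^3+14n}{6}+\dfrac{n^3+n(4p^4+10p^2)}{3p^2}, & \text{if } r=1. \end{cases}$$ Conversely, if $h(d)$ is odd and $$\sum_{\substack{ |t|<\sqrt{d}\\ t^2\equiv d \pmod 4}}\sigma\left(\frac{d-t^2}{4}\right)=\begin{cases} \dfrac{n^3+11n}{6}+ \dfrac{n^3+n(p^4+10p^2)}{3p^2}, & \text{if } r=4,\\[2mm] \dfrac{n^3+14n}{6}+\dfrac{n^3+n(4p^4+10p^2)}{3p^2}, & \text{if } r=1, \end{cases}$$ then $h(d)=3$.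
   Context: $h(d)$ denotes the class number of the real quadratic field $\mathbb{Q}(\sqrt{d})$. For a positive integer $m$, $\sigma(m)$ denotes the sum of the positive divisors of $m$. The sum runs over all integers $t$ (positive, negative or zero) satisfying the stated conditions. *)

(* Defs.v *)
From mathcomp Require Export all_boot all_order all_algebra all_field.
From mathcomp Require Export finmap.
From mathcomp Require Export mathcomp_extra boolp classical_sets functions.
From mathcomp Require Export cardinality fsbigop.

Set Implicit Arguments.
Unset Strict Implicit.
Unset Printing Implicit Defensive.
Export Order.TTheory GRing.Theory Num.Theory.

#[export] Set Implicit Arguments.
#[export] Unset Strict Implicit.
#[export] Unset Printing Implicit Defensive.

Local Open Scope classical_set_scope.
Local Open Scope ring_scope.

Definition squarefree (d : nat) : Prop :=
  forall k : nat, (k ^ 2 %| d)%N -> k = 1%N.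

Definition sigma (m : nat) : nat := (\sum_(k <- divisors m) k)%N.

(* Number fields are taken as subfields of algC. *)
Definition quadratic_field (d : nat) : set algC :=
  [set x | exists a b : rat, x = ratr a + ratr b * sqrtC d%:R].

Definition ring_of_integers (K : set algC) : set algC :=
  K `&` [set x | x \in Aint].

Definition nonzero_ideal (A I : set algC) : Prop :=
  [/\ I `<=` A, I 0,
      forall x y, I x -> I y -> I (x + y),
      forall a x, A a -> I x -> I (a * x)
    & exists2 x, I x & x != 0].

(* I and J are in the same class when a I = b J for nonzero a, b in A, i.e.
   when they differ by a principal fractional ideal. *)
Definition ideal_equiv (A I J : set algC) : Prop :=
  exists a b, [/\ A a, A b, a != 0, b != 0
                & [set a * x | x in I] = [set b * y | y in J]].

Definition ideal_class (A I : set algC) : set (set algC) :=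
  [set J | nonzero_ideal A J /\ ideal_equiv A I J].

Definition ideal_classes (A : set algC) : set (set (set algC)) :=
  [set ideal_class A I | I in nonzero_ideal A].

(* fset_set sends an infinite set to the empty one, so the value would be 0
   if there were infinitely many classes; it is never 0 for a number field. *)
Definition class_number (K : set algC) : nat :=
  #|` fset_set (ideal_classes (ring_of_integers K))|.

Definition sum_range (d : nat) : set int :=
  [set t : int | `|t|%:~R < sqrtC d%:R :> algC /\ (t ^+ 2 = d%:Z %[mod 4])%Z].

(* On sum_range the division by 4 is exact and d - t ^ 2 is nonnegative, so
   neither the integer quotient nor the absolute value loses anything. *)
Definition sigma_sum (d : nat) : rat :=
  \sum_(t \in sum_range d) ((sigma `|((d%:Z - t ^+ 2) %/ 4)%Z|%N)%:R : rat).

(* Main.v *)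
Require Import Defs.
From mathcomp Require Import zify ring.
Local Open Scope classical_set_scope.
Local Open Scope ring_scope.

(* Writing (d - t^2) / 4 = - a c with a > 0 > c, the divisor sum is the sum of the
   leading coefficients a over the forms [a, t, c] of discriminant d with
   a > 0 > c.  These forms are permuted by the steps along Conway's rivers, and,
   up to the symmetry [a, b, c] -> [- c, - b, - a], two of them lie on the same
   river exactly when the ideals Z a + Z (b + sqrt d) / 2 are equivalent; every
   ideal class is reached.  So the divisor sum is the sum over the ideal classes of
   positive contributions.

   With n = e u v, where (e, s) = (1, 2) if r = 4 and (2, 1) if r = 1, the cycle of
   [u, e u v - s, - v] can be written down; its contribution is
   e u v (e^2 (u^2 + v^2) + 10) / 6.  For u = 1 this is the principal class and for
   u = p the class A of a prime above p, while A^-1 contributes as much as A; the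
   right-hand side of the formula is the sum of these three.  A is not principal,
   since its form is not on the principal cycle, and if the class number is odd
   then A is different from A^-1.  So for an odd class number the formula holds
   exactly when there is no further class. *)

(** * Indefinite binary quadratic forms and Conway's river *)

(* [(a, b, c)] stands for [a X^2 + b X Y + c Y^2]. *)
Definition form := (int * int * int)%type.

(** These are the edges of Conway's topograph that lie on the river, oriented with the positive
    value first; Zagier calls such forms simple. *)
Definition simple (d : int) (f : form) : Prop :=
  let: (a, b, c) := f in [/\ b * b - 4 * a * c = d, 0 < a & c < 0].

(* The step along Conway's river: of the two edges leaving the vertex, the one
   that still separates the positive from the negative values of the form. *)
Definition river (f : form) : form :=
  let: (a, b, c) := f in
  if 0 < a + b + c then (a + b + c, b + 2 * c, c) else (a, b + 2 * a, a + b + c).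

Definition river_inv (f : form) : form :=
  let: (a, b, c) := f in
  if 0 < a - b + c then (a - b + c, b - 2 * c, c) else (a, b - 2 * a, a - b + c).

(* [flip f] has the same ideal class as [f]: exchanging the basis vectors of the
   ideal and dividing by an element of negative norm changes [f] into [flip f]. *)
Definition flip (f : form) : form := let: (a, b, c) := f in (- c, - b, - a).

(** On ideals this is conjugation, hence inversion of the class; on the topograph it reverses the
    direction of the river. *)
Definition opp_form (f : form) : form := let: (a, b, c) := f in (a, - b, c).

Lemma opp_formK : involutive opp_form.
Proof. by case=> [[a b] c] /=; rewrite opprK. Qed.

Lemma flipK : involutive flip.
Proof. by case=> [[a b] c] /=; rewrite !opprK. Qed.

Definition nonsquare (d : int) := forall x : int, x * x != d.

Lemma simple_opp d f : simple d f -> simple d (opp_form f).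
Proof. by case: f => [[a b] c] /= [h1 h2 h3]; split=> //; rewrite mulrNN. Qed.

Lemma simple_flip d f : simple d f -> simple d (flip f).
Proof. by case: f => [[a b] c] /= [h1 h2 h3]; split; [rewrite -h1; ring|lia|lia]. Qed.

(** If the sum vanished, the discriminant would be [(a - c)^2]. *)
Lemma simple_sum_neq0 d a b c : nonsquare d -> simple d (a, b, c) -> a + b + c != 0.
Proof.
move=> /(_ (a - c)) ns [h1 h2 h3]; apply: contra ns => /eqP h.
rewrite -h1; have -> : b = - (a + c) by lia.
by apply/eqP; ring.
Qed.

Lemma simple_river d f : nonsquare d -> simple d f -> simple d (river f).
Proof.
move=> ns; case: f => [[a b] c] hf; have := simple_sum_neq0 ns hf.
case: hf => [h1 h2 h3] /=; case: ltrgtP => // h _.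
  by split=> //; rewrite -h1; ring.
by split=> //; rewrite -h1; ring.
Qed.

(** [flip] negates [a + b + c], which is not 0, and so exchanges the two branches of [river]. *)
Lemma flip_river d f : nonsquare d -> simple d f ->
  river (flip f) = flip (river f).
Proof.
move=> ns; case: f => [[a b] c] hf; have := simple_sum_neq0 ns hf.
case: hf => [h1 h2 h3] /=; case: (ltrgtP (a + b + c) 0) => // h _.
- have -> : 0 < - c - b - a by lia.
  by congr (_, _, _); ring.
- have -> : 0 < - c - b - a = false by lia.
  by congr (_, _, _); ring.
Qed.

(** After a step, the value [a - b + c] of the new form is the old coefficient that was replaced;
    its sign tells which branch was taken. *)
Lemma riverK d f : simple d f -> river_inv (river f) = f.
Proof.
case: f => [[a b] c] /= [h1 h2 h3].
case: ltrP => h /=.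
- have -> : 0 < a + b + c - (b + 2 * c) + c by lia.
  by congr (_, _, _); ring.
- have -> : 0 < a - (b + 2 * a) + (a + b + c) = false by lia.
  by congr (_, _, _); ring.
Qed.

Lemma river_inv_opp f : river_inv f = opp_form (river (opp_form f)).
Proof. by case: f => [[a b] c] /=; case: ifP => h /=; congr (_, _, _); ring. Qed.

Lemma simple_iter d f k : nonsquare d -> simple d f -> simple d (iter k river f).
Proof. by move=> ns hf; elim: k => //= k; apply: simple_river. Qed.

(* The substitution sending the basis vectors to [(x, y)] and [(z, w)]. *)
Definition act (g : form) (x y z w : int) : form :=
  let: (a, b, c) := g in
  (a * x * x + b * x * y + c * y * y,
   2 * a * x * z + b * (x * w + y * z) + 2 * c * y * w,
   a * z * z + b * z * w + c * w * w).

(** If neither column dominates, then, say, [y < x] and [z < w]. So [x * w >= (y + 1) * (z + 1)]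
    exceeds [y * z] by at least [y + z + 1], and the determinant forces [y = z = 0]. *)
Lemma det1_columns (x y z w : int) :
  0 <= x -> 0 <= y -> 0 <= z -> 0 <= w ->
  (x * w - y * z = 1 \/ x * w - y * z = -1) ->
  [\/ y <= x /\ w <= z, x <= y /\ z <= w,
      [/\ x = 1, y = 0, z = 0 & w = 1] | [/\ x = 0, y = 1, z = 1 & w = 0]].
Proof.
move=> hx hy hz hw hD.
case: (lerP y x) => xy; case: (lerP w z) => zw; first by constructor 1.
- have [xy' | xy'] : y = x \/ y + 1 <= x by lia.
    by constructor 2; lia.
  have h : (y + 1) * (z + 1) <= x * w by apply: ler_pM => //; lia.
  have {}h : y * z + (y + z + 1) <= x * w by nia.
  have [y0 z0] : y = 0 /\ z = 0 by lia.
  have xw : x * w = 1 by move: hD; rewrite y0 z0; lia.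
  by constructor 3; split=> //; nia.
- have [zw' | zw'] : w = z \/ w + 1 <= z by lia.
    by constructor 2; lia.
  have h : (x + 1) * (w + 1) <= y * z by apply: ler_pM => //; lia.
  have {}h : x * w + (x + w + 1) <= y * z by nia.
  have [x0 w0] : x = 0 /\ w = 0 by lia.
  have yz : y * z = 1 by move: hD; rewrite x0 w0; lia.
  by constructor 4; split=> //; nia.
- by constructor 2; lia.
Qed.

(* Euclid's algorithm on the entries of the matrix: as long as it is not the
   identity, one column dominates the other, and the signs of the end
   coefficients force the corresponding column operation to be [river]. *)
Lemma act_nonneg d (g : form) (x y z w : int) : nonsquare d -> simple d g ->
  0 <= x -> 0 <= y -> 0 <= z -> 0 <= w ->
  (x * w - y * z = 1 \/ x * w - y * z = -1) ->
  0 < (act g x y z w).1.1 -> (act g x y z w).2 < 0 ->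
  x * w - y * z = 1 /\ exists k, act g x y z w = iter k river g.
Proof.
move=> ns; move e : (absz (x + y + z + w)) => N.
elim/ltn_ind: N g x y z w e => N IH [[a b] c] x y z w eN hf hx hy hz hw hD.
have [h1 h2 h3] := hf; have := simple_river ns hf.
have := simple_sum_neq0 ns hf; rewrite /=.
have hxz : 0 < x + z.
  rewrite lt_neqAle addr_ge0 // andbT; apply/eqP => h0.
  have [x0 z0] : x = 0 /\ z = 0 by lia.
  by move: hD; rewrite x0 z0; lia.
have hyw : 0 < y + w.
  rewrite lt_neqAle addr_ge0 // andbT; apply/eqP => h0.
  have [y0 w0] : y = 0 /\ w = 0 by lia.
  by move: hD; rewrite y0 w0; lia.
case: (ltrgtP (a + b + c) 0) => // hs _ hg hA hC;
  case: (det1_columns hx hy hz hw hD) =>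
    [[yx wz] | [xy zw] | [x1 y0 z0 w1] | [x1 y0 z0 w1]].
(* The antidiagonal matrix would put [c < 0] in first place; the identity corresponds to no step. *)
all: try by move: hA; rewrite x1 y0; lia.
all: try by split; [rewrite x1 y0 z0 w1 | exists 0%N; rewrite x1 y0 z0 w1;
  congr (_, _, _); ring].
- have E : act (a, b + 2 * a, a + b + c) (x - y) y (z - w) w = act (a, b, c) x y z w.
    by rewrite /act; congr (_, _, _); ring.
  have ED : (x - y) * w - y * (z - w) = x * w - y * z by ring.
  have [] : (x - y) * w - y * (z - w) = 1 /\
      exists k, act (a, b + 2 * a, a + b + c) (x - y) y (z - w) w
                = iter k river (a, b + 2 * a, a + b + c).
    by apply: (IH _ _ _ _ _ _ _ erefl); rewrite ?E ?ED //; lia.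
  rewrite ED E => hd [k hk]; split => //; exists k.+1.
  by rewrite -[LHS]/(act (a, b, c) x y z w) hk iterSr /=; have -> : 0 < a + b + c = false
      by lia.
(* Here the wrong column dominates. As [(x, y) = x (1, 1) + (y - x) (0, 1)], and all coefficients of
   the form in the basis [(1, 1)], [(0, 1)] are negative, [hA] fails. The next case contradicts [hC]
   in the same way, with the basis [(1, 0)], [(1, 1)]. *)
- have : 0 <= (- a - b - c) * x * x + (- b - 2 * c) * x * (y - x)
              + (- c) * (y - x) * (y - x).
    by rewrite !addr_ge0 // !mulr_ge0 //; lia.
  suff -> : (- a - b - c) * x * x + (- b - 2 * c) * x * (y - x)
              + (- c) * (y - x) * (y - x) = - (a * x * x + b * x * y + c * y * y) by lia.
  by ring.
- have : 0 <= a * (z - w) * (z - w) + (b + 2 * a) * (z - w) * w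
              + (a + b + c) * w * w.
    by rewrite !addr_ge0 // !mulr_ge0 //; lia.
  suff -> : a * (z - w) * (z - w) + (b + 2 * a) * (z - w) * w
              + (a + b + c) * w * w = a * z * z + b * z * w + c * w * w by lia.
  by ring.
- have E : act (a + b + c, b + 2 * c, c) x (y - x) z (w - z) = act (a, b, c) x y z w.
    by rewrite /act; congr (_, _, _); ring.
  have ED : x * (w - z) - (y - x) * z = x * w - y * z by ring.
  have [] : x * (w - z) - (y - x) * z = 1 /\
      exists k, act (a + b + c, b + 2 * c, c) x (y - x) z (w - z)
                = iter k river (a + b + c, b + 2 * c, c).
    by apply: (IH _ _ _ _ _ _ _ erefl); rewrite ?E ?ED //; lia.
  rewrite ED E => hd [k hk]; split => //; exists k.+1.
  by rewrite -[LHS]/(act (a, b, c) x y z w) hk iterSr /= hs.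
Qed.

(** Signs [e] and [e'] move both rows into the first quadrant. The determinant becomes [e * e'],
    which [act_nonneg] shows to be 1; so the signs agree and the form is unchanged. *)
Lemma act_same_cone d (g : form) (x y z w : int) : nonsquare d -> simple d g ->
  x * w - y * z = 1 -> simple d (act g x y z w) ->
  0 <= x * y -> 0 <= z * w -> exists k, act g x y z w = iter k river g.
Proof.
move=> ns hg hD hf hxy hzw.
have sgn a b : 0 <= a * b -> exists e : int,
    [/\ e = 1 \/ e = -1, 0 <= e * a & 0 <= e * b].
  move=> hab; case: (lerP 0 a) => ha; case: (lerP 0 b) => hb.
  - by exists 1; split; [left|lia|lia].
  - by exists (-1); split; [right|nia|nia].
  - by exists (-1); split; [right|nia|nia].
  - by exists (-1); split; [right|nia|nia].
have [e [he ex ey]] := sgn _ _ hxy; have [e' [he' ez ew]] := sgn _ _ hzw.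
case: g hg hf => [[a b] c] hg [_ hA hC].
have ee : e * e = 1 by case: he => ->.
have ee' : e' * e' = 1 by case: he' => ->.
have ED : e * x * (e' * w) - e * y * (e' * z) = e * e' * (x * w - y * z) by ring.
have [] := act_nonneg ns hg ex ey ez ew.
- by rewrite ED hD; case: he => ->; case: he' => ->; [left|right|right|left].
- suff -> : (act (a, b, c) (e * x) (e * y) (e' * z) (e' * w)).1.1
      = e * e * (a * x * x + b * x * y + c * y * y) by rewrite ee mul1r.
  by rewrite /=; ring.
- suff -> : (act (a, b, c) (e * x) (e * y) (e' * z) (e' * w)).2
      = e' * e' * (a * z * z + b * z * w + c * w * w) by rewrite ee' mul1r.
  by rewrite /=; ring.
rewrite ED hD mulr1 => E1 [k hk]; exists k; rewrite -hk /=.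
congr (_, _, _).
- by rewrite -[LHS]mul1r -ee; ring.
- by rewrite -[LHS]mul1r -E1; ring.
- by rewrite -[LHS]mul1r -ee'; ring.
Qed.

(* The columns cannot lie in the interiors of two adjacent quadrants, since the
   determinant would be at least 2; if both lie in the second or fourth quadrant,
   reflecting the form turns [river] into its inverse. *)
Lemma act_equiv d (g : form) (x y z w : int) : nonsquare d -> simple d g ->
  x * w - y * z = 1 -> simple d (act g x y z w) ->
  exists k, act g x y z w = iter k river g \/ act g x y z w = iter k river_inv g.
Proof.
move=> ns hg hD hf.
have hcone : 0 <= x * y /\ 0 <= z * w \/ x * y <= 0 /\ z * w <= 0.
  (* By the determinant this is [(y * z + 1) * (y * z)], a product of consecutive integers. *)
  have hlt : 0 <= (x * y) * (z * w).
    rewrite (_ : _ * _ = (x * w) * (y * z)); last by ring.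
    have -> : x * w = y * z + 1 by lia.
    have [h|h] : 0 <= y * z \/ y * z + 1 <= 0 by lia.
      by nia.
    by nia.
  by case: (ltrgtP (x * y) 0) hlt => [h|h|->]; rewrite ?(nmulr_rge0 _ h) ?(pmulr_rge0 _
      h); lia.
case: hcone => [[hxy hzw]|[hxy hzw]].
  by have [k ->] := act_same_cone ns hg hD hf hxy hzw; exists k; left.
have E : act (opp_form g) x (- y) (- z) w = opp_form (act g x y z w).
  by case: (g) => [[a b] c] /=; congr (_, _, _); ring.
have [k] : exists k, act (opp_form g) x (- y) (- z) w = iter k river (opp_form g).
  apply: (act_same_cone ns (simple_opp hg)); rewrite ?E //; try exact: simple_opp.
  - by rewrite -hD; ring.
  - by lia.
  - by lia.
rewrite E => /(congr1 opp_form); rewrite opp_formK => ->; exists k; right.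
elim: k => [|k IH]; first by rewrite /= opp_formK.
by rewrite !iterS -IH river_inv_opp opp_formK.
Qed.

(** For [e = -1], exchanging the two basis vectors gives a substitution of determinant 1 that takes
    [g] to [flip f]; this is where closure under [flip] enters. *)
Lemma act_closed d (C : form -> Prop) (f g : form) (x y z w e : int) :
  (forall h, C h -> [/\ C (river h), C (river_inv h) & C (flip h)]) ->
  nonsquare d -> simple d g -> simple d f -> C g ->
  e * e = 1 -> x * w - y * z = e ->
  act g x y z w = (e * f.1.1, e * f.1.2, e * f.2) -> C f.
Proof.
move=> hC ns hg hf Cg e1 hD E.
have Criver k h : C h -> C (iter k river h).
  by move=> Ch; elim: k => //= k IH; have [] := hC _ IH.
have Cinv k h : C h -> C (iter k river_inv h).
  by move=> Ch; elim: k => //= k IH; have [] := hC _ IH.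
have [e1' | e1'] : e = 1 \/ e = -1 by nia.
  have {}E : act g x y z w = f by rewrite E e1' !mul1r; case: (f) => [[]].
  have hs : simple d (act g x y z w) by rewrite E.
  have [k] := act_equiv ns hg (etrans hD e1') hs.
  by rewrite E => -[] ->; [apply: Criver | apply: Cinv].
have Ef : act g z w x y = flip f.
  case: g f E {hg hf Cg} => [[a b] c] [[a' b'] c'] /=; rewrite e1' => -[E1 E2 E3].
  by congr (_, _, _); rewrite -mulN1r -?E1 -?E2 -?E3; ring.
suff : C (flip f) by move/hC=> []; rewrite flipK.
have hD' : z * y - w * x = 1 by lia.
have hs : simple d (act g z w x y) by rewrite Ef; apply: simple_flip.
have [k] := act_equiv ns hg hD' hs.
by rewrite Ef => -[] ->; [apply: Criver | apply: Cinv].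
Qed.

(** * The explicit cycles *)

Lemma iter_flip d f k : nonsquare d -> simple d f ->
  iter k river (flip f) = flip (iter k river f).
Proof.
move=> ns hf; elim: k => //= k ->.
by rewrite (flip_river ns) //; apply: simple_iter.
Qed.

(* [H] is meant to be half of the period, with [flip f] at the antipode of [f]. *)
Definition cycle_of (f : form) (H : nat) : seq form := traject river f (H + H).

Lemma iter_cycle d f H : nonsquare d -> simple d f ->
  iter H river f = flip f -> iter (H + H) river f = f.
Proof. by move=> ns hf hH; rewrite iterD hH (iter_flip _ ns hf) hH flipK. Qed.

Lemma mem_cycle_of d f H g : nonsquare d -> simple d f -> (0 < H)%N ->
  iter H river f = flip f ->
  g \in cycle_of f H <-> exists k, g = iter k river f.
Proof.
move=> ns hf H0 hH; have hN := iter_cycle ns hf hH.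
split=> [/trajectP[i _ ->]|[k ->]]; first by exists i.
apply/trajectP; exists (k %% (H + H))%N; first by rewrite ltn_mod addn_gt0 H0.
rewrite {1}(divn_eq k (H + H)) addnC iterD; congr iter.
by elim: (_ %/ _)%N => // q IH; rewrite mulSn iterD IH.
Qed.

Lemma cycle_of_closed d f H g : nonsquare d -> simple d f -> (0 < H)%N ->
  iter H river f = flip f -> g \in cycle_of f H ->
  [/\ river g \in cycle_of f H, river_inv g \in cycle_of f H
    & flip g \in cycle_of f H].
Proof.
move=> ns hf H0 hH /(mem_cycle_of _ ns hf H0 hH)[k ->]; split;
  apply/(mem_cycle_of _ ns hf H0 hH).
- by exists k.+1.
- case: k => [|k]; last by exists k; apply: riverK; apply: simple_iter.
  (* The predecessor of [f] itself is the last entry, because the walk closes up after [H + H]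
     steps. *)
  exists (H + H).-1; rewrite /= -{1}(iter_cycle ns hf hH).
  have : (0 < H + H)%N by rewrite addn_gt0 H0.
  case: (H + H)%N => //= m _.
  by apply: riverK; apply: simple_iter.
- by exists (k + H)%N; rewrite iterD hH (iter_flip _ ns hf).
Qed.

Lemma cycle_of_simple d f H g : nonsquare d -> simple d f ->
  g \in cycle_of f H -> simple d g.
Proof. by move=> ns hf /trajectP[i _ ->]; apply: simple_iter. Qed.

(** The second half of the cycle is the [flip] of the first, so its leading coefficients are the
    negated last coefficients of the first half. *)
Lemma sum_cycle_of d f H : nonsquare d -> simple d f ->
  iter H river f = flip f ->
  \sum_(g <- cycle_of f H) g.1.1 =
  \sum_(i < H) ((iter i river f).1.1 - (iter i river f).2).
Proof.
move=> ns hf hH; rewrite big_split /=.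
have -> : cycle_of f H = mkseq (fun i => iter i river f) (H + H).
  apply: (@eq_from_nth _ f) => [|i]; first by rewrite size_traject size_mkseq.
  by rewrite size_traject => hi; rewrite nth_traject // nth_mkseq.
rewrite big_map -{1}[(H + H)%N]subn0 -/(index_iota _ _) big_mkord big_split_ord /=.
congr (_ + _); apply: eq_bigr => i _.
by rewrite addnC iterD hH (iter_flip _ ns hf); case: (iter i river f) => [[]].
Qed.

(** A repetition would make the last entry occur earlier; one more step would then reach [f] before
    the end of the period. *)
Lemma uniq_cycle_of f H : (0 < H)%N -> iter (H + H) river f = f ->
  (forall i, (0 < i < H + H)%N -> iter i river f <> f) -> uniq (cycle_of f H).
Proof.
move=> H0 hN hi; rewrite /cycle_of.
have : (0 < H + H)%N by rewrite addn_gt0 H0.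
case: (H + H)%N hN hi => [|m] hN hi _ //; rewrite looping_uniq; apply/negP.
move=> /trajectP[j jm hj].
by apply: (hi j.+1); rewrite ?ltnS //= -hj -[RHS]hN.
Qed.

Lemma sum_quadratic (a b c : int) (K : nat) :
  6 * (\sum_(k < K) (a + k%:Z * b - k%:Z * k%:Z * c)) =
  6 * a * K%:Z + 3 * b * K%:Z * (K%:Z - 1) - c * K%:Z * (K%:Z - 1) * (2 * K%:Z - 1).
Proof.
elim: K => [|K IH]; first by rewrite big_ord0; ring.
rewrite big_ord_recr mulrDr IH /=.
have -> : K.+1%:Z = K%:Z + 1 by lia.
by ring.
Qed.

Lemma mul_eq2 (e s : nat) : (e * s = 2)%N -> e = 1%N /\ s = 2 \/ e = 2 /\ s = 1%N.
Proof.
move=> es; have : (e %| 2)%N by rewrite -es dvdn_mulr.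
by rewrite dvdn_divisors // !inE => /orP[] /eqP ee; move: es; rewrite ee; lia.
Qed.

Section BaseCycle.

(* With [n = e u v] and [r = s ^ 2] the discriminant is [n ^ 2 + s ^ 2]; [u = 1]
   gives the principal class and [u = p] the class of a prime above [p]. *)
Variables e s u v : nat.
Hypotheses (es : (e * s = 2)%N) (u0 : (0 < u)%N) (sv : (s < v)%N).

Definition base_form : form := (u%:Z, e%:Z * u%:Z * v%:Z - s%:Z, - v%:Z).

(** Half of the cycle consists of two arms with constant last coefficient, first [- v] and then
    [- u]. The leading coefficient on the first arm is the value of [base_form] at [(1, k)]. The
    second arm starts at [j = 1], since [j = 0] would give the leading coefficient [- v]. *)
Definition base_arm1 (k : nat) : form :=
  (u%:Z + k%:Z * (e%:Z * u%:Z * v%:Z - s%:Z) - k%:Z * k%:Z * v%:Z,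
   e%:Z * u%:Z * v%:Z - s%:Z - 2 * k%:Z * v%:Z, - v%:Z).

Definition base_arm2 (j : nat) : form :=
  (- v%:Z + j%:Z * (e%:Z * u%:Z * v%:Z + s%:Z) - j%:Z * j%:Z * u%:Z,
   e%:Z * u%:Z * v%:Z + s%:Z - 2 * j%:Z * u%:Z, - u%:Z).

(** The cross term [- 2 e s u v] of the square cancels [4 u v] because [e s = 2]. *)
Lemma base_form_simple :
  simple ((e%:Z * u%:Z * v%:Z) ^+ 2 + s%:Z ^+ 2) base_form.
Proof.
split; [|lia|lia].
suff -> : (e%:Z * u%:Z * v%:Z - s%:Z) * (e%:Z * u%:Z * v%:Z - s%:Z) - 4 * u%:Z * - v%:Z =
  (e%:Z * u%:Z * v%:Z) ^+ 2 + s%:Z ^+ 2 + u%:Z * v%:Z * (4 - 2 * (e%:Z * s%:Z)).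
  have -> : e%:Z * s%:Z = 2 by lia.
  by ring.
by ring.
Qed.

Lemma iter_arm1 k : (k < e * u)%N -> iter k river base_form = base_arm1 k.
Proof.
elim: k => [|k IH] hk.
  by rewrite /base_arm1 /=; congr (_, _, _); ring.
rewrite iterS IH ?(ltnW hk) // /base_arm1 /=.
have -> : k.+1%:Z = k%:Z + 1 by lia.
rewrite ifT; first by congr (_, _, _); ring.
have h : (k%:Z + 1) * v%:Z + v%:Z <= e%:Z * u%:Z * v%:Z.
  have -> : (k%:Z + 1) * v%:Z + v%:Z = (k%:Z + 2) * v%:Z by ring.
  by rewrite ler_pM2r; lia.
have : 0 <= (k%:Z + 1) * (e%:Z * u%:Z * v%:Z - s%:Z - (k%:Z + 1) * v%:Z).
  by rewrite mulr_ge0; lia.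
set X := (X in 0 <= X) => hX; rewrite (_ : _ + _ = u%:Z + X); first by lia.
by rewrite /X; ring.
Qed.

(** For [0 < j < e v] the product [j (e v - j)] is at least [e v - 1], so the coefficient is at
    least [e v - 1 + s - v], which is positive in both cases of [e s = 2]. For [j = e v] it equals
    [v]. *)
Lemma base_arm2_gt0 j : (0 < j <= e * v)%N -> 0 < (base_arm2 j).1.1.
Proof.
move=> /andP[j0]; rewrite leq_eqVlt => /orP[/eqP ->|jv] /=.
  rewrite PoszM [X in 0 < X](_ : _ = v%:Z * (e%:Z * s%:Z - 1)); last by ring.
  by rewrite mulr_gt0 //; lia.
have h1 : 0 <= (j%:Z - 1) * (e%:Z * v%:Z - j%:Z - 1) by rewrite mulr_ge0 //; lia.
have h2 : j%:Z * (e%:Z * v%:Z - j%:Z) <= j%:Z * (e%:Z * v%:Z - j%:Z) * u%:Z.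
  by rewrite ler_peMr ?mulr_ge0 //; lia.
have h3 : s%:Z <= j%:Z * s%:Z by rewrite ler_peMl //; lia.
rewrite [X in 0 < X](_ : _ = j%:Z * (e%:Z * v%:Z - j%:Z) * u%:Z + j%:Z * s%:Z - v%:Z);
  last by ring.
by case: (mul_eq2 es) h1 h2 h3 => -[-> ->]; nia.
Qed.

(** The first arm occupies the positions 0 to [e u - 1]. The value at [(1, e u)] is
    [u (1 - e s) = - u], so there the river turns and [- u] replaces [- v]. *)
Lemma iter_arm2 j : (0 < j <= e * v)%N ->
  iter (e * u + j).-1 river base_form = base_arm2 j.
Proof.
have eu0 : (0 < e * u)%N by have := mul_eq2 es; lia.
have E1 : e%:Z * s%:Z = 2 by lia.
elim: j => // -[_ _|j IH hj].
  rewrite addn1 /= -(prednK eu0) /= iter_arm1 ?prednK //.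
  rewrite /base_arm1 /base_arm2 /=.
  have -> : (e * u).-1%:Z = e%:Z * u%:Z - 1 by lia.
  rewrite ifF.
    congr (_, _, _); apply/eqP; rewrite -subr_eq0; apply/eqP.
    + rewrite [LHS](_ : _ = u%:Z * (2 - e%:Z * s%:Z)); last by ring.
      by rewrite E1 subrr mulr0.
    + rewrite [LHS](_ : _ = 2 * u%:Z * (2 - e%:Z * s%:Z)); last by ring.
      by rewrite E1 subrr mulr0.
    + rewrite [LHS](_ : _ = u%:Z * (2 - e%:Z * s%:Z)); last by ring.
      by rewrite E1 subrr mulr0.
  rewrite [X in 0 < X](_ : _ = u%:Z * (1 - e%:Z * s%:Z)); last by ring.
  by rewrite E1; lia.
have -> : (e * u + j.+2).-1 = (e * u + j.+1).-1.+1 by lia.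
rewrite iterS IH; last by lia.
have := base_arm2_gt0 hj; rewrite /base_arm2 /=.
have -> : j.+2%:Z = j.+1%:Z + 1 by lia.
set X := (X in 0 < X) => hX.
rewrite ifT; first by congr (_, _, _); rewrite /X; ring.
by rewrite [Y in 0 < Y](_ : _ = X) // /X; ring.
Qed.

Definition base_half := (e * u + e * v).-1.

Lemma base_half_gt0 : (0 < base_half)%N.
Proof. by rewrite /base_half; have := mul_eq2 es; lia. Qed.

Lemma iter_base_half : iter base_half river base_form = flip base_form.
Proof.
have ev0 : (0 < e * v)%N by have := mul_eq2 es; lia.
rewrite iter_arm2 ?ev0 ?leqnn // /base_arm2 /base_form /=.
have E1 : e%:Z * s%:Z = 2 by lia.
rewrite PoszM; congr (_, _, _); apply/eqP; rewrite -subr_eq0; apply/eqP.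
- rewrite [LHS](_ : _ = v%:Z * (e%:Z * s%:Z - 2)); last by ring.
  by rewrite E1 subrr mulr0.
- by ring.
Qed.

Definition base_cycle := cycle_of base_form base_half.

Lemma base_halfP i : (i < base_half)%N ->
  (i < e * u)%N /\ iter i river base_form = base_arm1 i \/
  exists2 j, (0 < j < e * v)%N & iter i river base_form = base_arm2 j.
Proof.
rewrite /base_half => hi; case: (ltnP i (e * u)) => h.
  by left; rewrite iter_arm1.
have eu0 : (0 < e * u)%N by have := mul_eq2 es; lia.
right; exists (i.+1 - e * u)%N; first by lia.
by rewrite -iter_arm2; [congr iter; lia | lia].
Qed.

Lemma base_cycleP d g : nonsquare d -> simple d base_form -> g \in base_cycle ->
  [\/ exists2 k, (k < e * u)%N & g = base_arm1 k,
      exists2 j, (0 < j < e * v)%N & g = base_arm2 j,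
      exists2 k, (k < e * u)%N & g = flip (base_arm1 k)
    | exists2 j, (0 < j < e * v)%N & g = flip (base_arm2 j)].
Proof.
move=> ns hf /trajectP[i hi ->]; case: (ltnP i base_half) => h.
  case: (base_halfP h) => [[h1 ->]|[j h1 ->]]; first by constructor 1; exists i.
  by constructor 2; exists j.
rewrite -(subnK h) iterD iter_base_half (iter_flip _ ns hf).
have h' : (i - base_half < base_half)%N by lia.
case: (base_halfP h') => [[h1 ->]|[j h1 ->]].
  by constructor 3; exists (i - base_half)%N.
by constructor 4; exists j.
Qed.

Variable d : int.
Hypotheses (ns : nonsquare d) (hf : simple d base_form).

Lemma sum_base_cycle :
  6 * (\sum_(g <- base_cycle) g.1.1) =
  e%:Z * u%:Z * v%:Z * (e%:Z ^+ 2 * (u%:Z ^+ 2 + v%:Z ^+ 2) + 10).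
Proof.
have ec := mul_eq2 es.
have ev0 : (0 < e * v)%N by rewrite muln_gt0; lia.
rewrite (sum_cycle_of ns hf) ?iter_base_half //.
(* The half cycle has [e u] forms on the first arm and [e v - 1] on the second; [j = e v] already
   opens the other half. *)
have -> : base_half = (e * u + (e * v).-1)%N by rewrite /base_half; lia.
rewrite big_split_ord /=.
have -> : \sum_(i < e * u) ((iter i river base_form).1.1 - (iter i river base_form).2)
  = \sum_(i < e * u) (u%:Z + v%:Z + i%:Z * (e%:Z * u%:Z * v%:Z - s%:Z) - i%:Z * i%:Z *
      v%:Z).
  by apply: eq_bigr => i _; rewrite iter_arm1 //= ; ring.
have -> : \sum_(i < (e * v).-1) ((iter (e * u + i)%N river base_form).1.1 - (iter (e * u
    + i)%N river base_form).2)
  = \sum_(i < (e * v).-1) ((e%:Z * u%:Z * v%:Z + s%:Z - v%:Z) + i%:Z * (e%:Z * u%:Z *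
      v%:Z + s%:Z - 2 * u%:Z) - i%:Z * i%:Z * u%:Z).
  apply: eq_bigr => i _.
  have -> : (e * u + i)%N = (e * u + i.+1).-1 by lia.
  rewrite iter_arm2 //=; last by case: i => i /= ?; lia.
  have -> : i.+1%:Z = i%:Z + 1 by lia.
  by ring.
rewrite mulrDr !sum_quadratic.
have -> : (e * v).-1%:Z = e%:Z * v%:Z - 1 by lia.
have -> : (e * u)%:Z = e%:Z * u%:Z by lia.
by case: ec => -[-> ->]; ring.
Qed.

(** [base_form] must not recur on any of the four arms. On the first arm and on the flip of the
    second the middle coefficients differ. On the other two the end coefficients force [u = v], and
    then [s] would be a positive multiple of [v], against [s < v]. *)
Lemma uniq_base_cycle : odd u -> odd v -> uniq (base_cycle).
Proof.
move=> ou ov; have ec := mul_eq2 es.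
have fH : iter (base_half) river base_form = flip base_form.
  exact: iter_base_half.
apply: uniq_cycle_of; first exact: base_half_gt0.
  exact: (iter_cycle ns hf).
have v3 : (2 < v)%N.
  have v2 : v <> 2 by move=> h; rewrite h in ov.
  by lia.
move=> i /andP[i0 iN] E.
case: (ltnP i (base_half)) => h.
  case: (base_halfP h) => [[h1 E']|[j h1 E']];
    move: E; rewrite E' => E; have E1 := congr1 (fun f => f.1.1) E;
    have E2 := congr1 (fun f => f.1.2) E; have E3 := congr1 snd E;
    rewrite /= in E1 E2 E3.
    have : i%:Z * v%:Z = 0 by lia.
    by move/eqP; rewrite mulf_eq0; lia.
  have uv : u = v by lia.
  have : u%:Z * j%:Z = s%:Z by rewrite uv in E2 *; lia.
  have : u%:Z <= u%:Z * j%:Z by rewrite ler_peMr; lia.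
  by lia.
move: E; rewrite -(subnK h) iterD fH (iter_flip _ ns hf).
have h' : (i - base_half < base_half)%N by lia.
case: (base_halfP h') => [[h1 ->]|[j h1 ->]] E;
  have E1 := congr1 (fun f => f.1.1) E; have E2 := congr1 (fun f => f.1.2) E;
  have E3 := congr1 snd E; rewrite /= in E1 E2 E3.
  have uv : u = v by lia.
  set k := (i - _)%N in E1 E2 E3.
  have Ek : (e%:Z * u%:Z - k%:Z) * v%:Z = s%:Z by lia.
  have : v%:Z <= s%:Z.
    by rewrite -Ek ler_peMl //; lia.
  by lia.
have : u%:Z * (e%:Z * v%:Z - j%:Z) = 0 by lia.
by move/eqP; rewrite mulf_eq0; lia.
Qed.

End BaseCycle.

(** Each form of the principal cycle has last coefficient [- p q] or [- 1], or leading coefficient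
    [p q] or 1; here the end coefficients are [p] and [- q]. *)
Lemma notin_base_cycle1 e s p q d : (e * s = 2)%N -> (1 < p)%N -> (1 < q)%N ->
  (s < p * q)%N -> nonsquare d -> simple d (base_form e s 1 (p * q)) ->
  (base_form e s p q \notin base_cycle e s 1 (p * q)) &&
  (opp_form (base_form e s p q) \notin base_cycle e s 1 (p * q)).
Proof.
move=> es p1 q1 sv ns hf.
have pv : p <> (p * q)%N by nia.
have qv : q <> (p * q)%N by nia.
by rewrite -negb_or; apply/negP => /orP[] /(base_cycleP es (ltn0Sn 0) sv ns hf)
  [] [j h1]; rewrite /base_arm1 /base_arm2 /base_form => -[]; lia.
Qed.

(** * Ideals of the quadratic field *)

Lemma sqr_factor_square (b t d : int) : b != 0 -> b ^+ 2 * d = t ^+ 2 ->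
  exists x : int, d = x * x.
Proof.
move=> b0 h.
have : (`|b| ^ 2 %| `|t| ^ 2)%N by rewrite -!abszX -h abszM dvdn_mulr.
rewrite dvdn_pexp2r // => hbt.
have {}hbt : (b %| t)%Z by [].
exists (t %/ b)%Z; apply: (mulfI (expf_neq0 2 b0)); rewrite h.
by rewrite -{1}(divzK hbt); ring.
Qed.

(** The square of the denominator is coprime to that of the numerator, hence divides [d]. *)
Lemma squarefree_rat_int (d : nat) (q : rat) : squarefree d ->
  q ^+ 2 * d%:R \is a Num.int -> q \is a Num.int.
Proof.
move=> sq /intrP[k hk].
have hk' : numq q ^+ 2 * d%:Z = k * denq q ^+ 2.
  apply/eqP; rewrite -(eqr_int rat) !expr2 !intrM -hk expr2 -{3 4}(divq_num_den q).
  have hd : (denq q)%:~R != 0 :> rat by rewrite intr_eq0 denq_neq0.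
  by apply/eqP; rewrite -pmulrn; field.
have : (`|denq q| ^ 2 %| `|numq q| ^ 2 * d)%N.
  by rewrite -!mulnn; have := congr1 absz hk'; rewrite !expr2 !abszM /= => ->; rewrite
      dvdn_mull.
rewrite Gauss_dvdr; last by rewrite coprimeXl // coprimeXr // coprime_sym coprime_num_den.
move=> /sq hden; apply/intrP; exists (numq q); rewrite -{1}(divq_num_den q).
have -> : denq q = 1 by have := denq_gt0 q; lia.
by rewrite divr1.
Qed.

Lemma min_positive (P : int -> Prop) : (exists2 k, 0 < k & P k) ->
  exists2 k, 0 < k /\ P k & forall j, 0 < j -> P j -> k <= j.
Proof.
move=> [k0 k0p Pk0].
have absK j : 0 < j -> (absz j)%:Z = j by move=> j0; rewrite abszE gtr0_norm.
have ex : exists n : nat, `[< (0 < n)%N /\ P n%:Z >].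
  by exists (absz k0); apply/asboolP; rewrite absK //; split=> //; lia.
case: (ex_minnP ex) => k /asboolP[k1 k2] hk; exists k%:Z; first by [].
move=> j j0 Pj; rewrite -(absK j j0) lez_nat; apply: hk.
by apply/asboolP; rewrite absK //; split=> //; lia.
Qed.

Lemma even_fset_involution (T : choiceType) (F : T -> T) (X : {fset T}) :
  (forall x, x \in X -> [/\ F x \in X, F (F x) = x & F x != x]) ->
  ~~ odd #|` X|.
Proof.
move e : #|` X| => n; elim/ltn_ind: n X e => n IH X e hX.
have [X0|[x xX]] := fset_0Vmem X.
  by rewrite -e X0 cardfs0.
have [h1 h2 h3] := hX x xX.
have hFx : F x \in (X `\ x)%fset by rewrite !inE h3.
have eX := cardfsD1 x X; have eX' := cardfsD1 (F x) (X `\ x)%fset.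
rewrite xX in eX; rewrite hFx in eX'.
have en : n = #|` (X `\ x `\ F x)%fset|.+2 by rewrite -e eX eX'.
suff : ~~ odd #|` (X `\ x `\ F x)%fset| by rewrite en /= negbK.
apply: IH erefl _; first by rewrite en ltnS leqnSn.
move=> y; rewrite !inE => /and3P[y1 y2 yX]; have [k1 k2 k3] := hX y yX.
split=> //; rewrite k1 andbT; apply/andP; split.
  by apply: contraNneq y2 => h; rewrite -k2 h h2.
by apply: contraNneq y1 => h; rewrite -k2 h.
Qed.

Section QuadraticField.

Variables (d : nat) (m : int).
Hypotheses (dm : d%:Z = 4 * m + 1) (sqd : squarefree d) (nsd : nonsquare d%:Z).

Local Notation K := (quadratic_field d).
Local Notation O := (ring_of_integers K).
Local Notation s := (sqrtC d%:R : algC).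
Local Notation equiv := (ideal_equiv O).

(** * The ring of integers as [Z + Z omega] *)

Lemma sqrtC_sqr : s * s = d%:Z%:~R.
Proof. by rewrite -expr2 sqrtCK pmulrn. Qed.

Definition omega : algC := (1 + s) / 2.

Lemma omega_sqr : omega * omega = omega + m%:~R.
Proof.
have h : s * s = 4 * m%:~R + 1 by rewrite sqrtC_sqr dm rmorphD rmorphM.
have -> : omega * omega = (1 + 2 * s + s * s) / 4 by rewrite /omega; field.
by rewrite h /omega; field.
Qed.

Definition zomega (x y : int) : algC := x%:~R + y%:~R * omega.

(** For nonzero [b], the quotient [a / b] would be a rational, hence integral, square root of
    [d]. *)
Lemma sqrtC_irrational (a b : rat) : ratr a + ratr b * s = 0 -> a = 0 /\ b = 0.
Proof.
move=> h; have [b0|b0] := eqVneq b 0.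
  by move: h; rewrite b0 rmorph0 mul0r addr0 => /eqP; rewrite fmorph_eq0 => /eqP.
have hq : a ^+ 2 = b ^+ 2 * d%:R.
  have : (ratr a : algC) ^+ 2 = (ratr b * s) ^+ 2.
    by move/eqP: h; rewrite addr_eq0 => /eqP ->; rewrite sqrrN.
  have -> : (ratr b * s) ^+ 2 = ratr (b ^+ 2 * d%:R).
    have -> : (ratr b * s) ^+ 2 = ratr b ^+ 2 * (s * s) by ring.
    by rewrite sqrtC_sqr -pmulrn rmorphM rmorphXn /= ratr_nat.
  by rewrite -rmorphXn; apply: fmorph_inj.
(* The factor 1 prepares for [squarefree_rat_int] with the square-free number 1, by which [a / b] is
   an integer. *)
have : (a / b) ^+ 2 * 1%:R = d%:R by rewrite expr_div_n hq mulr1 mulrC mulKf ?expf_neq0.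
move=> h1.
have ai : a / b \is a Num.int.
  apply: (@squarefree_rat_int 1); first by move=> k; rewrite dvdn1 -[1%N](exp1n 2)
      eqn_exp2r // => /eqP.
  by rewrite h1 natr_int.
case/intrP: ai => t ht; move: h1; rewrite ht mulr1 -rmorphXn pmulrn => /eqP.
by rewrite eqr_int expr2 => /eqP h1; have := nsd t; rewrite h1 eqxx.
Qed.

Lemma zomegaD x y x' y' : zomega x y + zomega x' y' = zomega (x + x') (y + y').
Proof. by rewrite /zomega !rmorphD /=; ring. Qed.

Lemma zomegaM x y x' y' :
  zomega x y * zomega x' y' = zomega (x * x' + m * y * y') (x * y' + y * x' + y * y').
Proof.
rewrite /zomega !rmorphD !rmorphM /=.
have := omega_sqr; set w := omega => hw.
rewrite [LHS](_ : _ = x%:~R * x'%:~R + (x%:~R * y'%:~R + y%:~R * x'%:~R) * w + y%:~R *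
    y'%:~R * (w * w)); last by ring.
by rewrite hw; ring.
Qed.

Lemma omega_Aint : omega \in Aint.
Proof.
apply: (@root_monic_Aint ('X^2 - 'X - (m%:~R)%:P)).
- by rewrite /root !hornerE expr2 omega_sqr; apply/eqP; ring.
- rewrite -addrA monicE lead_coefDl ?lead_coefXn // size_polyXn.
  rewrite -opprD size_polyN (leq_ltn_trans (size_polyD _ _)) // gtn_max size_polyX.
  by rewrite (leq_ltn_trans (size_polyC_leq1 _)).
- apply/polyOverP => i; rewrite !coefE.
  apply: rpredB; first by apply: rpredB; apply: natr_int.
  by case: ifP; rewrite ?intr_int // rpred0.
Qed.

(** For [b != 0] the minimal polynomial is [q], so the trace [2 a] and the norm are integers. Then
    [(2 b)^2 d] is an integer and so is [2 b], [d] being square-free; [d = 1] modulo 4 gives [2 a]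
    and [2 b] the same parity. *)
Lemma quadratic_Aint x : K x -> x \in Aint -> exists a b, x = zomega a b.
Proof.
move=> [a [b xE]] xA.
have [b0|b0] := eqVneq b 0.
  have : x \in Num.int.
    by apply: Cint_rat_Aint => //; rewrite xE b0 rmorph0 mul0r addr0 Crat_rat.
  by move/intrP => [k ->]; exists k, 0; rewrite /zomega mul0r addr0.
have [p [minE pm pdiv]] := minCpolyP x.
pose q : {poly rat} := 'X^2 - (2 * a) *: 'X + (a ^+ 2 - b ^+ 2 * d%:R)%:P.
have qE : q = Poly [:: a ^+ 2 - b ^+ 2 * d%:R; - (2 * a); 1].
  apply/polyP => i; rewrite coef_Poly !coefE.
  by case: i => [|[|[|i]]] /=; rewrite ?nth_nil; ring.
have sq : size q = 3%N by rewrite qE (@PolyK _ 0) ?oner_neq0.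
have qm : q \is monic by rewrite monicE lead_coefE sq qE coef_Poly.
have rx : root (map_poly ratr q) x.
  rewrite /root /q rmorphD rmorphB /= map_polyXn map_polyZ map_polyX map_polyC /=.
  have h1 : ratr (2 * a) = 2 * ratr a :> algC by rewrite rmorphM /= ratr_nat.
  have h2 : ratr (a ^+ 2 - b ^+ 2 * d%:R) = ratr a ^+ 2 - ratr b ^+ 2 * (s * s).
    by rewrite rmorphB rmorphXn rmorphM rmorphXn /= ratr_nat sqrtC_sqr pmulrn.
  rewrite h1 h2 !hornerD hornerN hornerC hornerZ hornerXn hornerX xE.
  by apply/eqP; ring.
have pq : p %| q by rewrite -pdiv.
have rp : root (map_poly ratr p) x by rewrite -minE root_minCpoly.
have p0 : p != 0 by apply: monic_neq0.
(* A minimal polynomial of degree 1 would make [x] rational, so [b = 0]. *)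
have size_p : size p = 3%N.
  have : (size p <= 3)%N by rewrite -sq dvdp_leq // monic_neq0.
  rewrite leq_eqVlt => /orP[/eqP //|hs].
  have : (1 < size p)%N by rewrite -(size_map_poly (ratr : {rmorphism rat -> algC}))
      (root_size_gt1 _ rp) // map_poly_eq0.
  move=> hs'; have {hs'} hs : size p = 2%N by lia.
  have pE : p = 'X + (p`_0)%:P.
    apply/polyP => i; rewrite !coefE.
    move: pm; rewrite monicE lead_coefE hs /= => /eqP p1.
    case: i => [|[|i]] /=; rewrite ?p1 ?add0r ?addr0 //.
    by rewrite nth_default // hs.
  move: rp; rewrite pE rmorphD /= map_polyX map_polyC /root hornerD hornerX hornerC xE.
  rewrite addrAC -rmorphD => /eqP/sqrtC_irrational[_ bz].
  by rewrite bz eqxx in b0.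
have {}pq : p = q.
  by apply/eqP; rewrite -eqp_monic // -dvdp_size_eqp // size_p sq.
move: xA; rewrite [_ \in _]/(minCpoly x \is a polyOver Num.int) minE pq => /polyOverP
    hint.
have ratr_intK (c : rat) : ratr c \in (Num.int : {pred algC}) -> exists k : int, c =
    k%:~R.
  move=> /intrP[k hk]; exists k; apply: (fmorph_inj (ratr : {rmorphism rat -> algC})).
  by rewrite /= hk ratr_int.
have [k1] : exists k : int, - (2 * a) = k%:~R.
  by apply: ratr_intK; have := hint 1%N; rewrite coef_map qE coef_Poly.
have [N hN] : exists k : int, a ^+ 2 - b ^+ 2 * d%:R = k%:~R.
  by apply: ratr_intK; have := hint 0%N; rewrite coef_map qE coef_Poly.
move=> hk1; have {hk1} [A hA] : exists A : int, 2 * a = A%:~R.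
  by exists (- k1); rewrite intrN -hk1 opprK.
have [B hB] : exists B : int, 2 * b = B%:~R.
  apply/intrP; apply: (squarefree_rat_int sqd); apply/intrP.
  exists (A * A - 4 * N); rewrite intrB !intrM -hN -hA.
  by ring.
have hAB : A * A - B * B * d%:Z = 4 * N.
  apply/eqP; rewrite -(eqr_int rat) intrB !intrM -hN -hA -hB -pmulrn.
  by apply/eqP; ring.
have [C hC] : exists C, A = B + 2 * C.
  have h : (A * A) - (B * B) = 4 * (N + m * B * B) by rewrite dm in hAB; lia.
  have [C [hC|hC]] : exists C, A = B + 2 * C \/ A = B + 2 * C + 1.
    by exists ((A - B) %/ 2)%Z; lia.
  - by exists C.
  - by exfalso; move: h; rewrite hC; lia.
exists C, B; rewrite xE /zomega /omega.
have hb : ratr b = B%:~R / 2 :> algC.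
  have -> : b = B%:~R / 2 by rewrite -hB; field.
  by rewrite fmorph_div /= ratr_int ratr_nat.
have ha : ratr a = A%:~R / 2 :> algC.
  have -> : a = A%:~R / 2 by rewrite -hA; field.
  by rewrite fmorph_div /= ratr_int ratr_nat.
by rewrite ha hb hC intrD intrM; field.
Qed.

Lemma ring_of_integersP x : O x <-> exists a b, x = zomega a b.
Proof.
split=> [[Kx xA]|[a [b ->]]]; first exact: quadratic_Aint.
split.
  exists (a%:~R + b%:~R / 2), (b%:~R / 2).
  have -> : ratr (b%:~R / 2) = b%:~R / 2 :> algC by rewrite fmorph_div /= ratr_int
      ratr_nat.
  have -> : ratr (a%:~R + b%:~R / 2) = a%:~R + b%:~R / 2 :> algC.
    by rewrite rmorphD fmorph_div /= !ratr_int ratr_nat.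
  by rewrite /zomega /omega; field.
apply: rpredD; first exact: Aint_int.
by apply: rpredM; [exact: Aint_int | exact: omega_Aint].
Qed.

(** * The lattices attached to forms and their equivalence *)

Definition beta (b : int) : algC := (b%:~R + s) / 2.

Definition lattice (a b : int) : set algC :=
  [set z | exists x y : int, z = x%:~R * a%:~R + y%:~R * beta b].

Lemma beta_num k : beta (2 * k + 1) = zomega k 1.
Proof. by rewrite /beta /zomega /omega intrD intrM; field. Qed.

Lemma disc_odd (a b c : int) : b * b - 4 * a * c = d%:Z -> exists k, b = 2 * k + 1.
Proof.
rewrite dm => h; have [k [hk|hk]] : exists k, b = 2 * k + 1 \/ b = 2 * k.
- by exists (b %/ 2)%Z; lia.
- by exists k.
- by exfalso; move: h; rewrite hk; lia.
Qed.

Lemma beta_sqr (a b c : int) : b * b - 4 * a * c = d%:Z ->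
  beta b * beta b = b%:~R * beta b - a%:~R * c%:~R.
Proof.
move=> h; have hs : s * s = b%:~R * b%:~R - 4 * a%:~R * c%:~R.
  by rewrite sqrtC_sqr -h intrB !intrM.
have -> : beta b * beta b = (b%:~R * b%:~R + 2 * b%:~R * s + s * s) / 4.
  by rewrite /beta; field.
by rewrite hs /beta; field.
Qed.

(** [beta (- b)] is minus the conjugate of [beta b]; thus [lattice a (- b)] is the conjugate of
    [lattice a b]. *)
Lemma betaN b : beta (- b) = beta b - b%:~R.
Proof. by rewrite /beta intrN; field. Qed.

Lemma lin_indep b (x y : int) : x%:~R + y%:~R * beta b = 0 -> x = 0 /\ y = 0.
Proof.
move=> h; have [] : 2 * x + y * b = 0 /\ y = 0; last by move=> + y0; rewrite y0 mul0r;
    lia.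
have /sqrtC_irrational : ratr (2 * x + y * b)%:~R + ratr y%:~R * s = 0.
  by rewrite !ratr_int -[RHS](mulr0 2) -h /beta intrD !intrM; field.
by move=> [h1 h2]; split; apply/eqP; rewrite -(intr_eq0 rat) ?h1 ?h2.
Qed.

Lemma lin_indep2 b (x y x' y' : int) :
  x%:~R + y%:~R * beta b = x'%:~R + y'%:~R * beta b -> x = x' /\ y = y'.
Proof.
move=> h; suff : x - x' = 0 /\ y - y' = 0 by lia.
apply: (@lin_indep b); rewrite !intrB mulrBl addrACA -opprD.
by rewrite h subrr.
Qed.

Lemma integers_int (k : int) : O k%:~R.
Proof. by apply/ring_of_integersP; exists k, 0; rewrite /zomega mul0r addr0. Qed.

Lemma integersD x y : O x -> O y -> O (x + y).
Proof.
move=> /ring_of_integersP[a [b ->]] /ring_of_integersP[a' [b' ->]].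
by apply/ring_of_integersP; rewrite zomegaD; do 2!eexists.
Qed.

Lemma integersM x y : O x -> O y -> O (x * y).
Proof.
move=> /ring_of_integersP[a [b ->]] /ring_of_integersP[a' [b' ->]].
by apply/ring_of_integersP; rewrite zomegaM; do 2!eexists.
Qed.

Lemma integers_beta a b c : b * b - 4 * a * c = d%:Z -> O (beta b).
Proof.
by move=> /disc_odd[k ->]; rewrite beta_num; apply/ring_of_integersP; do 2!eexists.
Qed.

Lemma beta_neq0 b : beta b != 0.
Proof.
apply/eqP => h; have [] : (0 : int) = 0 /\ (1 : int) = 0; last by [].
by apply: (@lin_indep b); rewrite h mulr0 addr0.
Qed.

Lemma ideal_equivI I J (a b : algC) : O a -> O b -> a != 0 -> b != 0 ->
  (forall x, I x -> exists2 y, J y & a * x = b * y) ->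
  (forall y, J y -> exists2 x, I x & a * x = b * y) -> equiv I J.
Proof.
move=> Oa Ob a0 b0 h1 h2; exists a, b; split=> //; apply/seteqP; split=> z /=.
  by move=> [x /h1[y Jy ->] <-]; exists y.
by move=> [y /h2[x Jx <-] <-]; exists x.
Qed.

Lemma ideal_equivP I J : equiv I J -> exists a b : algC,
  [/\ O a, O b, a != 0, b != 0 &
    (forall x, I x -> exists2 y, J y & a * x = b * y) /\
    (forall y, J y -> exists2 x, I x & a * x = b * y)].
Proof.
move=> [a [b [Oa Ob a0 b0 E]]]; exists a, b; split=> //; split=> [x Ix|y Jy].
  have [y Jy h] : [set b * y | y in J] (a * x) by rewrite -E; exists x.
  by exists y.
have [x Ix h] : [set a * x | x in I] (b * y) by rewrite E; exists y.
by exists x.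
Qed.

Lemma ideal_equiv_refl I : equiv I I.
Proof.
by exists 1, 1; split; rewrite ?oner_neq0 //; apply: (integers_int 1).
Qed.

Lemma ideal_equiv_sym I J : equiv I J -> equiv J I.
Proof. by move=> [a [b [Oa Ob a0 b0 E]]]; exists b, a. Qed.

Lemma ideal_equiv_trans I J L : equiv I J -> equiv J L -> equiv I L.
Proof.
move=> /ideal_equivP[a [b [Oa Ob a0 b0 [h1 h2]]]] /ideal_equivP[a' [b' [Oa' Ob' a0' b0'
    [h1' h2']]]].
apply: (@ideal_equivI _ _ (a' * a) (b * b')); rewrite ?mulf_neq0 //; try exact: integersM.
- move=> x /h1[y /h1'[z Lz h'] h]; exists z => //.
  by rewrite -mulrA h mulrCA h' mulrA.
- move=> z /h2'[y /h2[x Lx h] h']; exists x => //.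
  by rewrite -mulrA h mulrCA h' mulrA.
Qed.

Lemma lattice_ideal a b c : b * b - 4 * a * c = d%:Z -> a != 0 -> nonzero_ideal O
    (lattice a b).
Proof.
move=> hd a0; split.
- move=> _ [x [y ->]]; apply: integersD; apply: integersM; try exact: integers_int.
  exact: integers_beta hd.
- by exists 0, 0; rewrite !mul0r addr0.
- move=> _ _ [x [y ->]] [x' [y' ->]]; exists (x + x'), (y + y').
  by rewrite !intrD; ring.
- move=> z _ /ring_of_integersP[u [v ->]] [x [y ->]].
  have [k bk] := disc_odd hd.
  (* Since [omega = beta b - k], these coordinates result from replacing the square of [beta b] by
     [b beta b - a c]. *)
  exists (u * x - v * k * x - v * y * c), (u * y + v * x * a - v * k * y + v * y * b).
  have -> : zomega u v = u%:~R - v%:~R * k%:~R + v%:~R * beta b.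
    by rewrite bk beta_num /zomega !rmorph1; ring.
  rewrite [LHS](_ : _ = (u%:~R - v%:~R * k%:~R) * (x%:~R * a%:~R + y%:~R * beta b) +
     v%:~R * x%:~R * a%:~R * beta b + v%:~R * y%:~R * (beta b * beta b)); last by ring.
  by rewrite (beta_sqr hd) !intrD !intrN !intrM; ring.
- exists a%:~R; last by rewrite intr_eq0.
  by exists 1, 0; rewrite mul1r mul0r addr0.
Qed.

Lemma lattice_shift a b k : lattice a (b + 2 * a * k) = lattice a b.
Proof.
have E : beta (b + 2 * a * k) = beta b + a%:~R * k%:~R.
  by rewrite /beta intrD !intrM; field.
apply/seteqP; split=> _ [x [y ->]].
  by exists (x + y * k), y; rewrite E intrD intrM; ring.
by exists (x - y * k), y; rewrite E intrB intrM; ring.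
Qed.

Lemma lattice_one : lattice 1 1 = O.
Proof.
have E : beta 1 = omega by rewrite /beta /omega.
apply/seteqP; split=> [_ [x [y ->]]|_ /ring_of_integersP[x [y ->]]].
  by apply/ring_of_integersP; exists x, y; rewrite E mulr1.
by exists x, y; rewrite E mulr1.
Qed.

(** Multiplication by [beta (- b)] takes the basis [a], [beta b] to [a beta (- b)], [- a c], which
    is [a] times a basis of the other lattice. *)
Lemma lattice_swap a b c : b * b - 4 * a * c = d%:Z -> a != 0 ->
  equiv (lattice a b) (lattice c (- b)).
Proof.
move=> hd a0; apply: (@ideal_equivI _ _ (beta (- b)) a%:~R).
- by apply: (@integers_beta a _ c); rewrite mulrNN.
- exact: integers_int.
- exact: beta_neq0.
- by rewrite intr_eq0.
- move=> _ [x [y ->]]; exists (y%:~R * c%:~R * -1 + x%:~R * beta (- b)).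
    by exists (- y), x; rewrite intrN; ring.
  rewrite [LHS](_ : _ = a%:~R * x%:~R * beta (- b) + y%:~R * (beta (- b) * beta b)); last
      by ring.
  have -> : beta (- b) * beta b = - (a%:~R * c%:~R).
    by rewrite betaN mulrBl (beta_sqr hd); ring.
  by ring.
- move=> _ [x [y ->]]; exists (y%:~R * a%:~R - x%:~R * beta b).
    by exists y, (- x); rewrite intrN; ring.
  rewrite [LHS](_ : _ = a%:~R * y%:~R * beta (- b) - x%:~R * (beta (- b) * beta b)); last
      by ring.
  have -> : beta (- b) * beta b = - (a%:~R * c%:~R).
    by rewrite betaN mulrBl (beta_sqr hd); ring.
  by ring.
Qed.

Definition form_lattice (f : form) := lattice f.1.1 f.1.2.

(** A step that keeps [a] keeps the lattice; a step that keeps [c] is a shift between two swaps. *)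
Lemma form_lattice_river f : simple d%:Z f -> equiv (form_lattice f) (form_lattice (river
    f)).
Proof.
case: f => [[a b] c] hf; have := simple_river nsd hf; have := simple_sum_neq0 nsd hf.
case: hf => [h1 h2 h3]; rewrite /form_lattice /=; case: ifP => h h0 [h4 h5 h6] /=.
- have a0 : a != 0 by lia.
  have c0 : c != 0 by lia.
  apply: ideal_equiv_trans (lattice_swap h1 a0) _; rewrite -(lattice_shift _ _ (-1)).
  have h7 : (- b + 2 * c * -1) * (- b + 2 * c * -1) - 4 * c * (a + b + c) = d%:Z.
    by rewrite -h4; ring.
  have := lattice_swap h7 c0; congr (equiv _ (lattice _ _)).
  by ring.
- have -> : b + 2 * a = b + 2 * a * 1 by ring.
  by rewrite lattice_shift; apply: ideal_equiv_refl.
Qed.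

Lemma form_lattice_iter f k : simple d%:Z f -> equiv (form_lattice f) (form_lattice (iter
    k river f)).
Proof.
move=> hf; elim: k => [|k IH]; first exact: ideal_equiv_refl.
by apply: ideal_equiv_trans IH _; apply/form_lattice_river/simple_iter.
Qed.

(** Gauss reduction: shift until [b] lies between [- a] and [a]. A negative last coefficient gives a
    simple form, and 0 would make [d] a square. A positive one is smaller than [a], since
    [4 a c' = b'^2 - d < a^2], so a swap lowers the leading coefficient. *)
Lemma lattice_reduce a b c : b * b - 4 * a * c = d%:Z -> 0 < a ->
  exists2 f, simple d%:Z f & equiv (lattice a b) (form_lattice f).
Proof.
move e : (absz a) => N; elim/ltn_ind: N a b c e => N IH a b c eN hd a0.
have [q hq] : exists q, - a <= b + 2 * a * q <= a.
  exists (- ((b + a) %/ (2 * a))%Z).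
  have := divz_eq (b + a) (2 * a); have a2 : 2 * a != 0 by lia.
  have := modz_ge0 (b + a) a2; have a2' : 0 < 2 * a by lia.
  have := ltz_pmod (b + a) a2'.
  by set Q := (_ %/ _)%Z; set R := (_ %% _)%Z; lia.
rewrite -(lattice_shift _ _ q).
have : exists c', (b + 2 * a * q) * (b + 2 * a * q) - 4 * a * c' = d%:Z.
  by exists (c + b * q + a * q * q); rewrite -hd; ring.
move: hq; set b' := b + _ => /andP[hb1 hb2] [c' hc'].
have bb : b' * b' <= a * a by nia.
have d0 : 0 < d%:Z.
  by rewrite lt_neqAle; apply/andP; split; [have := nsd 0; rewrite mul0r|].
case: (ltrgtP c' 0) => hcc.
- by exists (a, b', c') => //; apply: ideal_equiv_refl.
- have a0' : a != 0 by lia.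
  have hs := lattice_swap hc' a0'.
  have ca : c' < a by nia.
  have [] := IH (absz c') _ c' (- b') a erefl _ hcc; first by lia.
    by rewrite -hc'; ring.
  by move=> f hf hf'; exists f => //; apply: ideal_equiv_trans hs hf'.
- by have := nsd b'; rewrite -hc' hcc mulr0 subr0 eqxx.
Qed.

(* Cancelling the multiplier between the images of the two basis vectors and
   comparing coefficients of [1] and [sqrt d] gives linear equations on the
   change of basis matrix, which amount to its mapping one form to the other. *)
Lemma form_lattice_equiv_act f g : simple d%:Z f -> simple d%:Z g -> equiv (form_lattice
    f) (form_lattice g) ->
  exists x y z w e, [/\ e * e = 1, x * w - y * z = e
    & act g x y z w = (e * f.1.1, e * f.1.2, e * f.2)].
Proof.
case: f g => [[A B] C] [[a b] c] [hA1 hA2 hA3] [ha1 ha2 ha3].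
rewrite /form_lattice /= => /ideal_equivP[mu [nu [_ _ mu0 nu0 [h1 h2]]]].
have [|_ [x [y ->]] E1] := h1 A%:~R; first by exists 1, 0; rewrite mul1r mul0r addr0.
have [|_ [z [w ->]] E2] := h1 (beta B); first by exists 0, 1; rewrite mul1r mul0r add0r.
have [|_ [x2 [y2 ->]] E3] := h2 a%:~R; first by exists 1, 0; rewrite mul1r mul0r addr0.
have [|_ [z2 [w2 ->]] E4] := h2 (beta b); first by exists 0, 1; rewrite mul1r mul0r add0r.
have E5 : (x%:~R * a%:~R + y%:~R * beta b) * beta B
        = (z%:~R * a%:~R + w%:~R * beta b) * A%:~R.
  apply: (mulfI nu0); by rewrite mulrA -E1 [RHS]mulrA -E2; ring.
have [E6 E7] : 2 * x * a + y * b + y * B = 2 * A * w /\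
               (2 * x * a + y * b) * B + y * d%:Z = 2 * A * (2 * z * a + w * b).
  have : ratr ((2 * x * a + y * b) * B + y * d%:Z - 2 * A * (2 * z * a + w * b))%:~R
       + ratr (2 * x * a + y * b + y * B - 2 * A * w)%:~R * s = 0.
    rewrite !ratr_int !(intrD, intrN, intrM).
    have := congr1 (fun t => 4 * t) E5; rewrite /beta -sqrtC_sqr => /eqP.
    rewrite -subr_eq0 => /eqP h.
    by rewrite -[RHS]h; field.
  move/sqrtC_irrational => [/eqP + /eqP]; rewrite !intr_eq0; lia.
have E8 : 2 * A * z = x * (B - b) - 2 * c * y.
  have a0 : 2 * a != 0 by lia.
  apply: (mulfI a0); have Ew : 2 * A * w * b = (2 * x * a + y * b + y * B) * b by rewrite
      E6.
  rewrite -ha1 in E7.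
  by lia.
have D0 : A * (x * w - y * z) = a * x * x + b * x * y + c * y * y.
  have Ex : x * (2 * A * w) - y * (2 * A * z)
     = x * (2 * x * a + y * b + y * B) - y * (x * (B - b) - 2 * c * y) by rewrite E6 E8.
  by lia.
(* [M1] and [M2] say that the matrices of the two basis changes are inverse to each other, so the
   determinant is a unit. *)
have M1 : x2 * x + y2 * z = 1 /\ x2 * y + y2 * w = 0.
  have /lin_indep2 : ((x2 * x + y2 * z) * a)%:~R + (x2 * y + y2 * w)%:~R * beta b
     = a%:~R + (0:int)%:~R * beta b.
    apply: (mulfI nu0); rewrite mul0r addr0 -E3 [RHS]mulrDr [mu * (_ * A%:~R)]mulrCA E1
        [mu * (_ * beta B)]mulrCA E2.
    by rewrite !(intrD, intrM); ring.
  by move=> [h ->]; split=> //; apply: (mulIf (_ : a != 0)); [lia | rewrite h mul1r].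
have M2 : z2 * x + w2 * z = 0 /\ z2 * y + w2 * w = 1.
  have /lin_indep2 : ((z2 * x + w2 * z) * a)%:~R + (z2 * y + w2 * w)%:~R * beta b
     = (0:int)%:~R + (1:int)%:~R * beta b.
    apply: (mulfI nu0); rewrite mul1r add0r -E4 [RHS]mulrDr [mu * (_ * A%:~R)]mulrCA E1
        [mu * (_ * beta B)]mulrCA E2.
    by rewrite !(intrD, intrM); ring.
  by move=> [/eqP h ->]; split=> //; move: h; rewrite mulf_eq0; lia.
have De : (x2 * w2 - y2 * z2) * (x * w - y * z) = 1.
  case: M1 M2 => [m1 m2] [m3 m4].
  rewrite (_ : _ * _ = (x2 * x + y2 * z) * (z2 * y + w2 * w) - (x2 * y + y2 * w) * (z2 *
      x + w2 * z)); last by ring.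
  by rewrite m1 m2 m3 m4.
have ee : (x * w - y * z) * (x * w - y * z) = 1.
  have := congr1 absz De; rewrite abszM => /eqP; rewrite muln_eq1 => /andP[_ /eqP h].
  have [-> //|-> //] : x * w - y * z = 1 \/ x * w - y * z = -1 by lia.
exists x, y, z, w, (x * w - y * z); split=> //=.
set e := x * w - y * z in D0 *.
have A0 : 2 * A != 0 by lia.
have D1 : 2 * a * x * z + b * (x * w + y * z) + 2 * c * y * w = e * B.
  apply: (mulfI A0).
  rewrite [LHS](_ : _ = x * a * 2 * (2 * A * z) + b * (x * (2 * A * w) + y * (2 * A * z))
      + 2 * c * y * (2 * A * w)); last by ring.
  rewrite [RHS](_ : _ = 2 * B * (A * e)); last by ring.
  by rewrite D0 E8 -E6; ring.
congr (_, _, _); [by rewrite -D0 mulrC | exact: D1 | ].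
(* The last coefficient is recovered from the discriminant through [4 A C = B^2 - d]. *)
have AA0 : 4 * A * A != 0 by rewrite !mulf_neq0 //; lia.
apply: (mulfI AA0).
rewrite [LHS](_ : _ = a * (2 * A * z) * (2 * A * z) + b * (2 * A * z) * (2 * A * w) + c *
    (2 * A * w) * (2 * A * w)); last by ring.
rewrite [RHS](_ : _ = (A * e) * (B * B - (B * B - 4 * A * C))); last by ring.
by rewrite D0 E8 -E6 hA1 -ha1; ring.
Qed.

Lemma integers_zomega a b : O (zomega a b).
Proof. by apply/ring_of_integersP; do 2!eexists. Qed.

(** Hermite normal form: [I] is spanned over [Z] by its least positive integer [a0] and an element
    [h + k omega] with least positive [k]. Stability under [omega] makes [k] divide [a0] and [h];
    dividing by [k] leaves a lattice of the required shape. *)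
Lemma ideal_equiv_lattice I : nonzero_ideal O I ->
  exists a b c, [/\ 0 < a, b * b - 4 * a * c = d%:Z & equiv I (lattice a b)].
Proof.
move=> [IO I0 ID IM [x0 Ix0 x0n]].
have IMn a b x y : I (zomega x y) -> I (zomega (a * x + m * b * y) (a * y + b * x + b *
    y)).
  by move=> h; rewrite -zomegaM; apply: IM => //; apply: integers_zomega.
have IB x y x' y' : I (zomega x y) -> I (zomega x' y') -> I (zomega (x - x') (y - y')).
  move=> h /(IMn (-1) 0) h'; have := ID _ _ h h'; rewrite zomegaD.
  by congr (I (zomega _ _)); ring.
have IZ a x y : I (zomega x y) -> I (zomega (a * x) (a * y)).
  by move=> /(IMn a 0); congr (I (zomega _ _)); ring.
have [x [y xy]] : exists x y, I (zomega x y) /\ (x != 0) || (y != 0).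
  have [x [y E]] := (ring_of_integersP x0).1 (IO _ Ix0).
  exists x, y; rewrite -E; split=> //; apply: contraNT x0n.
  by rewrite negb_or !negbK E => /andP[/eqP -> /eqP ->]; rewrite /zomega !mul0r addr0.
case: xy => Ixy xy0.
(* Four times this norm of [x + y omega] is [(2 x + y)^2 - d y^2]. *)
have norm0 : x * x + x * y - m * y * y != 0.
  apply/eqP => h0; have h : (2 * x + y) * (2 * x + y) = y * y * d%:Z by rewrite dm; lia.
  have [y0|y0] := eqVneq y 0.
    by move: h0 xy0; rewrite y0 eqxx orbF !mulr0 subr0 addr0 => /eqP; rewrite mulf_eq0
        orbb => ->.
  have [|z hz] := @sqr_factor_square y (2 * x + y) d%:Z y0.
    by rewrite !expr2 -h.
  by have := nsd z; rewrite hz eqxx.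
have INorm : I (zomega (x * x + x * y - m * y * y) 0).
  by have := IMn (x + y) (- y) _ _ Ixy; congr (I (zomega _ _)); ring.
have [a0 [a0p Ia0] mina] : exists2 k, 0 < k /\ I (zomega k 0) & forall j, 0 < j -> I
    (zomega j 0) -> k <= j.
  apply: min_positive; set N := _ - _ in norm0 INorm.
  exists `|N|; first by rewrite normr_gt0.
  case: (lerP 0 N) => hN; first by rewrite ger0_norm.
  by rewrite ltr0_norm //; have := IZ (-1) _ _ INorm; rewrite mulr0 mulN1r.
have [k [kp [h Ih]] mink] : exists2 k, 0 < k /\ (exists h, I (zomega h k)) &
    forall j, 0 < j -> (exists h, I (zomega h j)) -> k <= j.
  apply: min_positive; exists a0 => //; exists 0.
  by have := IMn 0 1 _ _ Ia0; congr (I (zomega _ _)); ring.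
have kdvd u v : I (zomega u v) -> exists q, v = q * k.
  move=> Iuv; exists (v %/ k)%Z; have := divz_eq v k.
  have kn : k != 0 by lia.
  have r0 := modz_ge0 v kn; have rk := ltz_pmod v kp.
  set q := (v %/ k)%Z in r0 rk *; set r := (v %% k)%Z in r0 rk * => E.
  case: (ltrgtP r 0) => hr; [by lia | | by rewrite E hr addr0].
  have : k <= r.
    apply: mink => //; exists (u - q * h).
    by have := IB _ _ _ _ Iuv (IZ q _ _ Ih); congr (I (zomega _ _)); lia.
  by lia.
have advd u : I (zomega u 0) -> exists q, u = q * a0.
  move=> Iuv; exists (u %/ a0)%Z; have := divz_eq u a0.
  have kn : a0 != 0 by lia.
  have r0 := modz_ge0 u kn; have rk := ltz_pmod u a0p.
  set q := (u %/ a0)%Z in r0 rk *; set r := (u %% a0)%Z in r0 rk * => E.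
  case: (ltrgtP r 0) => hr; [by lia | | by rewrite E hr addr0].
  have : a0 <= r.
    apply: mina => //.
    by have := IB _ _ _ _ Iuv (IZ q _ _ Ia0); congr (I (zomega _ _)); lia.
  by lia.
have [a a0E] : exists a, a0 = a * k.
  by apply: (kdvd 0); have := IMn 0 1 _ _ Ia0; congr (I (zomega _ _)); ring.
have [h' hE] : exists h', h = h' * k.
  have [|q hq] := kdvd (m * k) (h + k).
    by have := IMn 0 1 _ _ Ih; congr (I (zomega _ _)); ring.
  by exists (q - 1); lia.
(* Multiplying [k (h' + omega)] by the conjugate [h' + 1 - omega] puts [k] times the norm of
   [h' + omega] into [I], so [a0 = a k] divides it. *)
have [c cE] : exists c, h' * h' + h' - m = c * a.
  have [|q hq] := advd (k * (h' * h' + h' - m)).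
    have := IMn (h' + 1) (-1) _ _ Ih; rewrite hE.
    by congr (I (zomega _ _)); ring.
  exists q; have kn : k != 0 by lia.
  by apply: (mulfI kn); rewrite hq a0E; ring.
exists a, (2 * h' + 1), c; split.
- by nia.
- by rewrite dm; lia.
have ap : 0 < a by nia.
apply: (@ideal_equivI _ _ 1 k%:~R); try exact: oner_neq0.
- exact: (integers_int 1).
- exact: integers_int.
- by rewrite intr_eq0; lia.
- move=> t It; have [u [v tE]] := (ring_of_integersP t).1 (IO _ It).
  move: It; rewrite tE => Iuv; have [q qE] := kdvd _ _ Iuv.
  have [|q' qE'] := advd (u - q * h).
    by have := IB _ _ _ _ Iuv (IZ q _ _ Ih); congr (I (zomega _ _)); lia.
  exists (q'%:~R * a%:~R + q%:~R * beta (2 * h' + 1)); first by exists q', q.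
  have -> : u = q' * a * k + q * h' * k by rewrite -mulrA -a0E -qE' hE; ring.
  by rewrite beta_num /zomega qE !(intrD, intrM) !rmorph1; ring.
- move=> _ [u [v ->]]; exists (zomega (u * a0 + v * h) (v * k)).
    have := ID _ _ (IZ u _ _ Ia0) (IZ v _ _ Ih); rewrite zomegaD.
    by congr (I (zomega _ _)); ring.
  by rewrite a0E hE beta_num /zomega !(intrD, intrM) !rmorph1; ring.
Qed.

Lemma ideal_equiv_simple I : nonzero_ideal O I ->
  exists2 f, simple d%:Z f & equiv I (form_lattice f).
Proof.
move=> /ideal_equiv_lattice[a [b [c [a0 hd h]]]].
have [f hf hf'] := lattice_reduce hd a0.
exists f => //; exact: (ideal_equiv_trans h hf').
Qed.

(** * Multiplication of ideals *)

Lemma primitive a b c : b * b - 4 * a * c = d%:Z ->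
  exists e1 e2 e3, a * e1 + b * e2 + c * e3 = 1.
Proof.
move=> hd.
have [u1 [v1 E1]] := Bezoutz a b; have [u2 [v2 E2]] := Bezoutz (gcdz a b) c.
have gz : (gcdz (gcdz a b) c) = 1.
  set g := gcdz _ c.
  have ga : (g %| a)%Z by rewrite (dvdz_trans _ (dvdz_gcdl a b)) ?dvdz_gcdl.
  have gb : (g %| b)%Z by rewrite (dvdz_trans _ (dvdz_gcdr a b)) ?dvdz_gcdl.
  have gc : (g %| c)%Z by rewrite dvdz_gcdr.
  (* The discriminant is quadratic in the coefficients; as it is square-free, they have no common
     factor. *)
  have : (g ^+ 2 %| d%:Z)%Z.
    move: ga gb gc => /dvdzP[x ax] /dvdzP[y bx] /dvdzP[z cx].
    by apply/dvdzP; exists (y * y - 4 * x * z); rewrite -hd ax bx cx; ring.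
  rewrite dvdzE abszX => /sqd g1; have g0 : 0 <= g by [].
  by rewrite -(ger0_norm g0) -abszE g1.
by exists (u2 * u1), (u2 * v1), v2; rewrite -gz -E2 -E1; ring.
Qed.

Lemma beta_mulN a b c : b * b - 4 * a * c = d%:Z ->
  beta (- b) * beta b = - (a%:~R * c%:~R).
Proof. by move=> hd; rewrite betaN mulrBl (beta_sqr hd); ring. Qed.

(* The product of [I] with the ideal generated by [p] and [beta b]. *)
Definition ideal_prod (p b : int) (I : set algC) : set algC :=
  [set z | exists x y, [/\ I x, I y & z = p%:~R * x + beta b * y]].

Lemma ideal_prod_ideal p b c I : b * b - 4 * p * c = d%:Z -> p != 0 ->
  nonzero_ideal O I -> nonzero_ideal O (ideal_prod p b I).
Proof.
move=> hd p0 [IO I0 ID IM [x0 Ix0 x0n]].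
have Ob := integers_beta hd.
split.
- move=> _ [x [y [Ix Iy ->]]]; apply: integersD.
    by apply: integersM; [exact: integers_int | exact: IO].
  by apply: integersM => //; exact: IO.
- by exists 0, 0; rewrite !mulr0 addr0.
- move=> _ _ [x [y [Ix Iy ->]]] [x' [y' [Ix' Iy' ->]]].
  by exists (x + x'), (y + y'); split; [exact: ID | exact: ID | ring].
- move=> a _ Oa [x [y [Ix Iy ->]]].
  by exists (a * x), (a * y); split; [exact: IM | exact: IM | ring].
- exists (p%:~R * x0); last by rewrite mulf_neq0 // intr_eq0.
  by exists x0, 0; rewrite mulr0 addr0.
Qed.

Lemma ideal_prod_equiv p b I J : equiv I J ->
  equiv (ideal_prod p b I) (ideal_prod p b J).
Proof.
move=> /ideal_equivP[u [v [Ou Ov u0 v0 [h1 h2]]]].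
apply: (ideal_equivI (a := u) (b := v)) => //.
- move=> _ [x [y [/h1[x' Jx ex] /h1[y' Jy ey] ->]]].
  exists (p%:~R * x' + beta b * y'); first by exists x', y'.
  by rewrite !mulrDr !(mulrCA v) -ex -ey; ring.
- move=> _ [x [y [/h2[x' Jx ex] /h2[y' Jy ey] ->]]].
  exists (p%:~R * x' + beta b * y'); first by exists x', y'.
  by rewrite !mulrDr !(mulrCA v) -ex -ey; ring.
Qed.

Lemma ideal_prod_congr p b q b' I : nonzero_ideal O I ->
  equiv (lattice p b) (lattice q b') -> equiv (ideal_prod p b I) (ideal_prod q b' I).
Proof.
move=> [IO I0 ID IM _].
(* It suffices to follow the two generators. The inclusion is stated for arbitrary multipliers to
   serve both directions. *)
have half p1 b1 p2 b2 (u v : algC) :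
    (forall x, lattice p1 b1 x -> exists2 y, lattice p2 b2 y & u * x = v * y) ->
    forall x, ideal_prod p1 b1 I x -> exists2 y, ideal_prod p2 b2 I y & u * x = v * y.
  move=> h _ [x [y [Ix Iy ->]]].
  have [|_ [k1 [l1 ->]] e1] := h p1%:~R; first by exists 1, 0; rewrite mul1r mul0r addr0.
  have [|_ [k2 [l2 ->]] e2] := h (beta b1); first by exists 0, 1; rewrite mul1r mul0r
      add0r.
  exists (p2%:~R * (k1%:~R * x + k2%:~R * y) + beta b2 * (l1%:~R * x + l2%:~R * y)).
    by do 2!eexists; split; last reflexivity; apply: ID; apply: IM => //; apply:
        integers_int.
  rewrite [LHS](_ : _ = (u * p1%:~R) * x + (u * beta b1) * y); last by ring.
  by rewrite e1 e2; ring.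
move=> /ideal_equivP[u [v [Ou Ov u0 v0 [h1 h2]]]].
apply: (ideal_equivI (a := u) (b := v)) => //; first exact: half h1.
have h2' x : lattice q b' x -> exists2 y, lattice p b y & v * x = u * y.
  by move=> /h2[y hy e]; exists y.
by move=> x /(half _ _ _ _ _ _ h2')[y hy e]; exists y.
Qed.

(* The ideal [(p, beta b)] times its conjugate is [(p)], because
   [gcd(p, b, c) = 1]. *)
Lemma ideal_prod_conj p b c I : b * b - 4 * p * c = d%:Z -> p != 0 ->
  nonzero_ideal O I -> equiv (ideal_prod p (- b) (ideal_prod p b I)) I.
Proof.
move=> hd p0 [IO I0 ID IM _]; have [e1 [e2 [e3 he]]] := primitive hd.
have Ob := integers_beta hd.
have OI k := integers_int k.
have Ob' : O (beta (- b)) by apply: (@integers_beta p _ c); rewrite mulrNN.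
have bb := beta_mulN hd.
have I1 k x : I x -> I (k%:~R * x) by move=> Ix; apply: IM.
apply: (ideal_equivI (a := 1) (b := p%:~R)); rewrite ?oner_neq0 ?intr_eq0 //.
- exact: (OI 1).
- move=> _ [_ [_ [[x [y [Ix Iy ->]]] [x' [y' [Ix' Iy' ->]]] ->]]].
  exists (p%:~R * x + beta b * y + beta (- b) * x' + (- c)%:~R * y').
    exact: (ID _ _ (ID _ _ (ID _ _ (IM _ _ _ Ix) (IM _ _ Ob Iy)) (IM _ _ Ob' Ix')) (IM _
        _ _ Iy')).
  rewrite mul1r [LHS](_ : _ = p%:~R * (p%:~R * x + beta b * y) + p%:~R * (beta (- b) *
      x') + beta (- b) * beta b * y'); last by ring.
  by rewrite bb intrN; ring.
- move=> x Ix; exists (p%:~R * x) => //; last by rewrite mul1r.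
  (* The product of the two ideals contains [p^2], [p (beta b - beta (- b)) = p b] and
     [- beta (- b) beta b = p c], which the Bezout coefficients combine to [p]. *)
  exists (p%:~R * (e1%:~R * x) + beta b * (e2%:~R * x)),
         (p%:~R * ((- e2)%:~R * x) + beta b * ((- e3)%:~R * x)); split.
  + by exists (e1%:~R * x), (e2%:~R * x); split; try exact: I1.
  + by exists ((- e2)%:~R * x), ((- e3)%:~R * x); split; try exact: I1.
  + rewrite !intrN [RHS](_ : _ = p%:~R * x * (p%:~R * e1%:~R + (beta b - beta (- b)) *
      e2%:~R) - (beta (- b) * beta b) * e3%:~R * x); last by ring.
    rewrite bb betaN opprB addrCA subrr addr0.
    have : (p * e1 + b * e2 + c * e3)%:~R = 1 :> algC by rewrite he.
    rewrite !intrD !intrM => h.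
    transitivity (p%:~R * x * (p%:~R * e1%:~R + b%:~R * e2%:~R + c%:~R * e3%:~R)); last
        by ring.
    by rewrite h mulr1.
Qed.

(* [I] is invertible: [(a, beta b')] times its conjugate is [(a)]. *)
Lemma ideal_prod_fix p b c a b' c' : b * b - 4 * p * c = d%:Z -> p != 0 ->
  b' * b' - 4 * a * c' = d%:Z -> a != 0 ->
  equiv (ideal_prod p b (lattice a b')) (lattice a b') -> equiv (lattice p b) O.
Proof.
move=> hd p0 hd' a0 /ideal_equivP[x [y [Ox Oy x0 y0 [h1 h2]]]].
have [PO P0 PD PM _] := lattice_ideal hd p0.
have [IO I0 ID IM _] := lattice_ideal hd' a0.
have [e1 [e2 [e3 he]]] := primitive hd'.
have OI k := integers_int k.
have Ob' : O (beta (- b')) by apply: (@integers_beta a _ c'); rewrite mulrNN.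
have bb := beta_mulN hd'.
have aR0 : a%:~R != 0 :> algC by rewrite intr_eq0.
have Ia : lattice a b' a%:~R by exists 1, 0; rewrite mul1r mul0r addr0.
have Ib : lattice a b' (beta b') by exists 0, 1; rewrite mul1r mul0r add0r.
(* This recovers [a z] from the products of [z] with the generators of the lattice and the conjugate
   generators, so that statements about [z] times the lattice descend to [z]. *)
have he' (z : algC) : a%:~R * z = e1%:~R * (z * a%:~R) * a%:~R + e2%:~R * a%:~R * (z *
    beta b')
    - e2%:~R * (beta (- b') * (z * a%:~R)) - e3%:~R * (beta (- b') * (z * beta b')).
  rewrite [RHS](_ : _ = a%:~R * z * (e1%:~R * a%:~R + e2%:~R * (beta b' - beta (- b'))) -
      e3%:~R * z * (beta (- b') * beta b')); last by ring.
  rewrite bb betaN opprB addrCA subrr addr0.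
  have : (a * e1 + b' * e2 + c' * e3)%:~R = 1 :> algC by rewrite he.
  rewrite !intrD !intrM => h.
  transitivity (a%:~R * z * (a%:~R * e1%:~R + b'%:~R * e2%:~R + c'%:~R * e3%:~R)); last
      by ring.
  by rewrite h mulr1.
have conj_mul j : lattice a b' j -> exists2 t, O t & beta (- b') * j = a%:~R * t.
  move=> [k [l ->]]; exists (k%:~R * beta (- b') + (- l * c')%:~R).
    by apply: integersD => //; apply: integersM.
  rewrite mulrDr [in LHS](mulrCA _ _ (beta b')) bb intrM intrN; ring.
have PI z i : lattice p b z -> lattice a b' i -> ideal_prod p b (lattice a b') (z * i).
  move=> [u [v ->]] Ii; exists (u%:~R * i), (v%:~R * i).
  by split; [exact: IM | exact: IM | ring].
have PP w : ideal_prod p b (lattice a b') w -> lattice p b w.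
  move=> [i [i' [Ii Ii' ->]]]; apply: PD; rewrite mulrC; apply: PM; try exact: IO.
    by exists 1, 0; rewrite mul1r mul0r addr0.
  by exists 0, 1; rewrite mul1r mul0r add0r.
have conj_prod w : ideal_prod p b (lattice a b') w ->
    exists2 q, lattice p b q & beta (- b') * w = a%:~R * q.
  move=> [i [i' [/conj_mul[t Ot et] /conj_mul[t' Ot' et'] ->]]].
  exists (t * p%:~R + t' * beta b).
    apply: PD; apply: PM => //; first by exists 1, 0; rewrite mul1r mul0r addr0.
    by exists 0, 1; rewrite mul1r mul0r add0r.
  by rewrite mulrDr !(mulrCA (beta (- b'))) et et'; ring.
apply: (ideal_equivI (a := x) (b := y)) => //.
- move=> z Pz; have [j1 J1 E1] := h1 _ (PI _ _ Pz Ia).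
  have [j2 J2 E2] := h1 _ (PI _ _ Pz Ib).
  have [t1 O1 T1] := conj_mul _ J1; have [t2 O2 T2] := conj_mul _ J2.
  exists (e1%:~R * j1 + e2%:~R * j2 + (- e2)%:~R * t1 + (- e3)%:~R * t2).
    by do 3?[apply: integersD]; apply: integersM => //; exact: IO.
  apply: (mulfI aR0); rewrite [LHS](_ : _ = x * (a%:~R * z)); last by ring.
  rewrite he' [LHS](_ : _ = e1%:~R * (x * (z * a%:~R)) * a%:~R + e2%:~R * a%:~R * (x * (z
      * beta b'))
    - e2%:~R * beta (- b') * (x * (z * a%:~R)) - e3%:~R * beta (- b') * (x * (z * beta
        b'))); last by ring.
  rewrite E1 E2 [LHS](_ : _ = y * (e1%:~R * j1 * a%:~R + e2%:~R * a%:~R * j2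
    - e2%:~R * (beta (- b') * j1) - e3%:~R * (beta (- b') * j2))); last by ring.
  by rewrite T1 T2 !intrN; ring.
- move=> o Oo.
  have [w1 W1 E1] := h2 _ (IM _ _ Oo Ia); have [w2 W2 E2] := h2 _ (IM _ _ Oo Ib).
  have [t1 P1 T1] := conj_prod _ W1; have [t2 P2 T2] := conj_prod _ W2.
  exists (e1%:~R * w1 + e2%:~R * w2 + (- e2)%:~R * t1 + (- e3)%:~R * t2).
    exact: (PD _ _ (PD _ _ (PD _ _ (PM _ _ (OI e1) (PP _ W1)) (PM _ _ (OI e2) (PP _ W2)))
      (PM _ _ (OI (- e2)) P1)) (PM _ _ (OI (- e3)) P2)).
  apply: (mulfI aR0); rewrite [RHS](_ : _ = y * (a%:~R * o)); last by ring.
  rewrite he' [RHS](_ : _ = e1%:~R * (y * (o * a%:~R)) * a%:~R + e2%:~R * a%:~R * (y * (o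
      * beta b'))
    - e2%:~R * beta (- b') * (y * (o * a%:~R)) - e3%:~R * beta (- b') * (y * (o * beta
        b'))); last by ring.
  rewrite -E1 -E2 [RHS](_ : _ = x * (e1%:~R * w1 * a%:~R + e2%:~R * a%:~R * w2
    - e2%:~R * (beta (- b') * w1) - e3%:~R * (beta (- b') * w2))); last by ring.
  by rewrite T1 T2 !intrN; ring.
Qed.

Lemma ideal_class_eq I J : nonzero_ideal O I -> nonzero_ideal O J ->
  ideal_class O I = ideal_class O J <-> equiv I J.
Proof.
move=> hI hJ; split=> [E|E].
  have [] : ideal_class O I J; last by [].
  by rewrite E; split=> //; exact: ideal_equiv_refl.
apply/seteqP; split=> L [hL h]; split=> //.
  exact: (ideal_equiv_trans (ideal_equiv_sym E) h).
exact: (ideal_equiv_trans E h).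
Qed.

(** An infinite set would give the default value 0; finiteness is obtained in this way from an odd
    class number. *)
Lemma class_number_finite : class_number K <> 0%N -> finite_set (ideal_classes O).
Proof.
move=> h; apply: contrapT => hinf; apply: h.
by rewrite /class_number /fset_set; case: pselect => //; rewrite cardfs0.
Qed.

(* Otherwise multiplication by [(p, beta b)] would be an involution without
   fixed points of the set of ideal classes. *)
Lemma odd_class_number_conj p b c : b * b - 4 * p * c = d%:Z -> p != 0 ->
  odd (class_number K) -> equiv (lattice p b) (lattice p (- b)) -> equiv (lattice p b) O.
Proof.
move=> hd p0 hodd hpp; apply: contrapT => hP.
have fin : finite_set (ideal_classes O).
  by apply: class_number_finite => h; rewrite h in hodd.
pose rep (C : set (set algC)) := xget set0 [set I | nonzero_ideal O I /\ ideal_class O I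
    = C].
have repP C : ideal_classes O C -> nonzero_ideal O (rep C) /\ ideal_class O (rep C) = C.
  by move=> [I hI EI]; apply: (@xgetPex _ set0 [set I | nonzero_ideal O I /\ ideal_class
      O I = C]); exists I.
pose F C := ideal_class O (ideal_prod p b (rep C)).
move: hodd; apply/negP; apply: (@even_fset_involution _ F) => C.
rewrite in_fset_set // inE => hC.
have [hI EI] := repP _ hC.
have hPI := ideal_prod_ideal hd p0 hI.
have hFC : ideal_classes O (F C) by exists (ideal_prod p b (rep C)).
have [hI' EI'] := repP _ hFC.
split.
- by rewrite in_fset_set // inE.
- rewrite -[RHS]EI; apply/(ideal_class_eq (ideal_prod_ideal hd p0 hI') hI).
  have h1 : equiv (rep (F C)) (ideal_prod p b (rep C)) by apply/ideal_class_eq.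
  apply: (ideal_equiv_trans (ideal_prod_equiv p b h1)).
  (* The second multiplication may use the conjugate ideal instead, which undoes the first. *)
  apply: (ideal_equiv_trans (ideal_prod_congr hPI hpp)).
  exact: ideal_prod_conj hd p0 hI.
- apply/eqP => E; apply: hP.
  have h1 : equiv (ideal_prod p b (rep C)) (rep C) by apply/(ideal_class_eq hPI hI);
      rewrite EI.
  have [[[a b'] c'] [hg1 hg2 hg3] hg] := ideal_equiv_simple hI.
  have a0 : a != 0 by lia.
  apply: (ideal_prod_fix hd p0 hg1 a0).
  apply: (ideal_equiv_trans (ideal_prod_equiv p b (ideal_equiv_sym hg))).
  exact: (ideal_equiv_trans h1 hg).
Qed.

End QuadraticField.

(** * The divisor sum as a sum over forms *)

Section SigmaSum.
Variable d : nat.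

(** An explicit list for [sum_range d]; [t * t < d] implies the crude bound that [t] lies between
    [- d] and [d]. *)
Definition middle_range : seq int :=
  [seq t <- [seq i%:Z - d%:Z | i <- iota 0 (d + d).+1]
  | (t * t < d%:Z) && ((t ^+ 2 %% 4)%Z == (d%:Z %% 4)%Z)].

Lemma mem_middle_range t : (t \in middle_range) =
  (t * t < d%:Z) && ((t ^+ 2 %% 4)%Z == (d%:Z %% 4)%Z).
Proof.
rewrite mem_filter andb_idr // => /andP[h _]; apply/mapP; exists (absz (t + d%:Z)).
  rewrite mem_iota /= add0n.
  have : - d%:Z <= t <= d%:Z by nia.
  by lia.
have : - d%:Z <= t by nia.
by lia.
Qed.

Lemma uniq_middle_range : uniq middle_range.
Proof. by rewrite filter_uniq // map_inj_uniq ?iota_uniq // => i j /addIr[]. Qed.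

Lemma lt_sqrtC_int (t : int) : (`|t|%:~R < sqrtC d%:R :> algC) = (t * t < d%:Z).
Proof.
rewrite -(ltr_pXn2r (ltn0Sn 1)) ?nnegrE ?sqrtC_ge0 ?ler0n ?ler0z //.
rewrite sqrtCK -rmorphXn /= pmulrn ltr_int.
by rewrite real_normK ?num_real // expr2.
Qed.

Lemma sum_rangeE : sum_range d = [set` middle_range].
Proof.
apply/seteqP; split=> t /=; rewrite mem_middle_range.
  by move=> [h1 h2]; rewrite -lt_sqrtC_int h1 h2 eqxx.
by move=> /andP[h1 /eqP h2]; split => //; rewrite lt_sqrtC_int.
Qed.

Definition middle_quotient (t : int) : nat := `|((d%:Z - t ^+ 2) %/ 4)%Z|%N.

Lemma middle_quotientE t : t \in middle_range ->
  4 * (middle_quotient t)%:Z = d%:Z - t * t /\ (0 < middle_quotient t)%N.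
Proof.
rewrite mem_middle_range /middle_quotient expr2 => /andP[h1 /eqP h2].
by set T := t * t in h1 h2 *; lia.
Qed.

Definition simple_forms : seq form :=
  [seq (a%:Z, t, - (middle_quotient t %/ a)%N%:Z)
  | t <- middle_range, a <- divisors (middle_quotient t)].

Lemma uniq_simple_forms : uniq simple_forms.
Proof.
apply: allpairs_uniq_dep; first exact: uniq_middle_range.
  by move=> t _; apply: divisors_uniq.
by move=> [t a] [t' a'] _ _ /= [<- <-].
Qed.

Lemma mem_simple_forms f : f \in simple_forms <-> simple d%:Z f.
Proof.
split.
  move=> /allpairsPdep[t [a [ht ha ->]]].
  have [h1 h2] := middle_quotientE ht.
  move: ha; rewrite -dvdn_divisors // => /dvdnP[q hq].
  have a0 : (0 < a)%N by move: h2; rewrite hq muln_gt0 => /andP[].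
  have q0 : (0 < q)%N by move: h2; rewrite hq muln_gt0 => /andP[].
  rewrite hq mulnK //; split; [|lia|lia].
  by rewrite hq PoszM in h1; lia.
case: f => [[a b] c] [h1 h2 h3].
have hb : b \in middle_range.
  rewrite mem_middle_range; apply/andP; split; first by nia.
  by apply/eqP; rewrite -h1 expr2; set B := b * b; set C := a * c; rewrite -mulrA -/C;
      lia.
have [k1 k2] := middle_quotientE hb.
have hq : middle_quotient b = (absz a * absz c)%N.
  suff : 4 * (middle_quotient b)%:Z = 4 * ((absz a)%:Z * (absz c)%:Z) by lia.
  by rewrite k1 -h1 !abszE gtr0_norm // ltr0_norm //; ring.
have ab0 : (0 < absz a)%N by lia.
apply/allpairsPdep; exists b, (absz a); split=> //.
  by rewrite -dvdn_divisors // hq dvdn_mulr.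
by rewrite hq mulKn // !abszE gtr0_norm // ltr0_norm // opprK.
Qed.

Lemma sigma_sumE : sigma_sum d = (\sum_(f <- simple_forms) f.1.1)%:~R.
Proof.
rewrite /sigma_sum sum_rangeE -fsbig_seq ?uniq_middle_range //.
rewrite big_allpairs_dep /= rmorph_sum /=; apply: eq_bigr => t _.
by rewrite /sigma natr_sum rmorph_sum /=; apply: eq_bigr => a _; rewrite pmulrn.
Qed.

End SigmaSum.

(** Leading coefficients of simple forms are positive, so each form missing from [C] makes the full
    sum strictly larger. *)
Lemma sum_simple_forms d (C : seq form) : uniq C ->
  {in C, forall f, simple d%:Z f} ->
  \sum_(f <- simple_forms d) f.1.1 = \sum_(f <- C) f.1.1 <->
  (forall f, simple d%:Z f -> f \in C).
Proof.
move=> uC hC; rewrite (bigID (mem C)) /= -[X in X + _]big_filter.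
have pC : perm_eq [seq f <- simple_forms d | f \in C] C.
  apply: uniq_perm => //; first by rewrite filter_uniq // uniq_simple_forms.
  by move=> f; rewrite mem_filter andb_idr // => /hC/mem_simple_forms.
rewrite (perm_big _ pC) /=; split=> [|h].
  rewrite -[RHS]addr0 => /addrI h0 f hf; apply: contraT => fC.
  have fS : f \in simple_forms d by apply/mem_simple_forms.
  move: h0; rewrite (big_rem f) //= fC; set Z := \sum_(_ <- _ | _) _ => h0.
  have f0 : 0 < f.1.1 by case: (f) hf => [[a b] c] [].
  have : 0 <= Z.
    rewrite /Z big_seq_cond sumr_ge0 // => g /andP[/mem_rem/mem_simple_forms hg _].
    by case: g hg => [[a b] c] [_ /ltW].
  by lia.
rewrite [X in _ + X]big_seq_cond [X in _ + X]big1 ?addr0 // => f /andP[/mem_simple_forms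
    hf].
by rewrite h //; exact: hf.
Qed.

(** Squares are 0, 1 or 4 modulo 8. *)
Lemma nonsquare_mod8 d : (d = 5 %[mod 8])%N -> nonsquare d%:Z.
Proof.
move=> hd x; apply/eqP => h.
have [k [i [xE hi]]] : exists k i : int, x = 8 * k + i /\ 0 <= i < 8.
  by exists (x %/ 8)%Z, (x %% 8)%Z; lia.
have hd' : exists j : int, d%:Z = 8 * j + 5 by exists (d %/ 8)%N%:Z; lia.
case: hd' => j hj; move: h; rewrite hj xE.
have [->|[->|[->|[->|[->|[->|[->| ->]]]]]]] : i = 0 \/ i = 1 \/ i = 2 \/ i = 3 \/ i = 4
    \/ i = 5 \/ i = 6 \/ i = 7 by lia.
all: lia.
Qed.

(** * The three cycles and the class number *)

Section ThreeCycles.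
Variables (e s p q d : nat).
Hypotheses (es : (e * s = 2)%N) (p1 : (1 < p)%N) (op : odd p) (oq : odd q)
  (sq : (s < q)%N) (hd : d = ((e * p * q) ^ 2 + s ^ 2)%N)
  (hd8 : (d = 5 %[mod 8])%N) (sqd : squarefree d).

Local Notation K := (quadratic_field d).
Local Notation O := (ring_of_integers K).
Local Notation equiv := (ideal_equiv O).
Local Notation form_lattice := (form_lattice d).
Local Notation lattice := (lattice d).
Local Notation m := (d %/ 4)%N%:Z.

Let nsd : nonsquare d%:Z := nonsquare_mod8 hd8.
Let dm : d%:Z = 4 * m + 1.
Proof. by lia. Qed.

Let spq : (s < p * q)%N.
Proof. by apply: (leq_trans sq); rewrite leq_pmull // ltnW. Qed.

Let f0 := base_form e s 1 (p * q).
Let f1 := base_form e s p q.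
Let C0 := base_cycle e s 1 (p * q).
Let C1 := base_cycle e s p q.
Let C2 := map opp_form C1.

Lemma principal_form_simple : simple d%:Z f0.
Proof.
have := base_form_simple es (ltn0Sn 0) spq; congr (simple _ _).
by rewrite hd -!mulnn !expr2; lia.
Qed.

Lemma prime_form_simple : simple d%:Z f1.
Proof.
have := base_form_simple es (ltnW p1) sq; congr (simple _ _).
by rewrite hd -!mulnn !expr2; lia.
Qed.

Definition river_closed (C : seq form) := forall g, g \in C ->
  [/\ river g \in C, river_inv g \in C & flip g \in C].

Lemma principal_cycle_closed : river_closed C0.
Proof.
move=> g; apply: (cycle_of_closed nsd principal_form_simple (base_half_gt0 es _ spq)) =>
    //.
exact: iter_base_half.
Qed.

Lemma prime_cycle_closed : river_closed C1.
Proof.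
move=> g; apply: (cycle_of_closed nsd prime_form_simple (base_half_gt0 es (ltnW p1) sq))
    => //.
exact: (iter_base_half es (ltnW p1) sq).
Qed.

(** [opp_form] exchanges [river] with [river_inv] and commutes with [flip]. *)
Lemma conj_cycle_closed : river_closed C2.
Proof.
move=> _ /mapP[g hg ->]; have [h1 h2 h3] := prime_cycle_closed hg.
split; apply/mapP.
- by exists (river_inv g); rewrite // river_inv_opp opp_formK.
- by exists (river g); rewrite // river_inv_opp opp_formK.
- by exists (flip g) => //; case: (g) => [[a b] c].
Qed.

(** Equivalent lattices differ by a basis change of determinant 1 or -1, which [act_closed] resolves
    into river steps and flips. *)
Lemma mem_river_closed C g f : river_closed C -> g \in C -> simple d%:Z g ->
  simple d%:Z f -> equiv (form_lattice f) (form_lattice g) -> f \in C.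
Proof.
move=> hC gC hg hf /(form_lattice_equiv_act dm nsd hf hg)[x [y [z [w [k [k1 k2 k3]]]]]].
exact: (act_closed (C := fun h => h \in C) hC nsd hg hf gC k1 k2 k3).
Qed.

Lemma mem_principal_cycle : f0 \in C0.
Proof. by apply/(mem_cycle_of _ nsd principal_form_simple (base_half_gt0 es _ spq)) =>
    //; [exact: iter_base_half | exists 0%N]. Qed.

Lemma mem_prime_cycle : f1 \in C1.
Proof.
apply/(mem_cycle_of _ nsd prime_form_simple (base_half_gt0 es (ltnW p1) sq)).
  exact: (iter_base_half es (ltnW p1) sq).
by exists 0%N.
Qed.

Lemma mem_conj_cycle : opp_form f1 \in C2.
Proof. by apply: map_f; exact: mem_prime_cycle. Qed.

Lemma principal_cycle_equiv f : f \in C0 -> equiv (form_lattice f0) (form_lattice f).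
Proof. by move=> /trajectP[k _ ->]; exact: (form_lattice_iter dm sqd nsd _
    principal_form_simple). Qed.

Lemma prime_cycle_equiv f : f \in C1 -> equiv (form_lattice f1) (form_lattice f).
Proof. by move=> /trajectP[k _ ->]; exact: (form_lattice_iter dm sqd nsd _
    prime_form_simple). Qed.

(** The reflected cycle runs backwards: [river] takes the reflection of form [k + 1] to that of form
    [k]. *)
Lemma conj_cycle_equiv f : f \in C2 -> equiv (form_lattice (opp_form f1)) (form_lattice
    f).
Proof.
move=> /mapP[_ /trajectP[k _ ->] ->].
elim: k => [|k IH]; first exact: (ideal_equiv_refl dm sqd nsd).
apply: (ideal_equiv_trans dm sqd nsd IH); apply: ideal_equiv_sym.
have hk : simple d%:Z (iter k river f1) by apply: simple_iter nsd prime_form_simple.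
have hk' : simple d%:Z (iter k.+1 river f1) by apply: simple_iter nsd prime_form_simple.
have := form_lattice_river dm sqd nsd (simple_opp hk'); congr (equiv _ (form_lattice _)).
rewrite iterS -[in RHS](riverK hk) river_inv_opp opp_formK.
by [].
Qed.

Lemma three_cycles_simple : {in C0 ++ C1 ++ C2, forall f, simple d%:Z f}.
Proof.
move=> f; rewrite !mem_cat => /or3P[h|h|/mapP[g h ->]].
- exact: cycle_of_simple nsd principal_form_simple h.
- exact: cycle_of_simple nsd prime_form_simple h.
- by apply: simple_opp; exact: cycle_of_simple nsd prime_form_simple h.
Qed.

Lemma prime_not_principal : ~ equiv (form_lattice f1) (form_lattice f0).
Proof.
move/(mem_river_closed principal_cycle_closed mem_principal_cycle principal_form_simple
    prime_form_simple).
have q1 : (1 < q)%N by have := mul_eq2 es; lia.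
have /andP[/negP] := notin_base_cycle1 es p1 q1 spq nsd principal_form_simple.
by [].
Qed.

Lemma conj_not_principal : ~ equiv (form_lattice (opp_form f1)) (form_lattice f0).
Proof.
move/(mem_river_closed principal_cycle_closed mem_principal_cycle principal_form_simple
    (simple_opp prime_form_simple)).
have q1 : (1 < q)%N by have := mul_eq2 es; lia.
have /andP[_ /negP] := notin_base_cycle1 es p1 q1 spq nsd principal_form_simple.
by [].
Qed.

Lemma prime_not_conj : odd (class_number K) -> ~ equiv (form_lattice f1) (form_lattice
    (opp_form f1)).
Proof.
move=> hodd h12; apply: prime_not_principal.
case: (prime_form_simple) => hB _ _.
have pn : p%:Z != 0 by lia.
have := odd_class_number_conj dm sqd nsd hB pn hodd h12.
(* The leading coefficient is 1 and the middle one is odd, so this lattice is a shift of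
   [lattice 1 1]. *)
suff -> : form_lattice f0 = O by [].
rewrite -(lattice_one dm sqd nsd); have [h0 _ _] := principal_form_simple.
have [k hk] := disc_odd dm h0.
rewrite /form_lattice /=; rewrite hk.
by have := lattice_shift d 1 1 k; rewrite mulr1 [2 * k + 1]addrC.
Qed.

Lemma form_lattice_ideal f : simple d%:Z f -> nonzero_ideal O (form_lattice f).
Proof.
by case: f => [[a b] c] [h1 h2 h3]; apply: (lattice_ideal dm sqd nsd h1); lia.
Qed.

Let c0 := ideal_class O (form_lattice f0).
Let c1 := ideal_class O (form_lattice f1).
Let c2 := ideal_class O (form_lattice (opp_form f1)).

Lemma uniq_classes : odd (class_number K) -> uniq [:: c0; c1; c2].
Proof.
move=> hodd; have h0 := form_lattice_ideal principal_form_simple; have h1 :=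
    form_lattice_ideal prime_form_simple.
have h2 := form_lattice_ideal (simple_opp prime_form_simple).
rewrite /= !inE negb_or !andbT; apply/andP; split; [apply/andP; split|]; apply/eqP => E.
- exact: prime_not_principal ((ideal_class_eq dm sqd nsd h1 h0).1 (esym E)).
- exact: conj_not_principal ((ideal_class_eq dm sqd nsd h2 h0).1 (esym E)).
- exact: (prime_not_conj hodd) ((ideal_class_eq dm sqd nsd h1 h2).1 E).
Qed.

(** The class is constant along each cycle, and a list closed under the moves contains all simple
    forms in the class of any of its members. *)
Lemma mem_three_cycles f : simple d%:Z f ->
  (f \in C0 ++ C1 ++ C2) <-> ideal_class O (form_lattice f) \in [:: c0; c1; c2].
Proof.
move=> hf; have h := form_lattice_ideal hf.
have h0 := form_lattice_ideal principal_form_simple; have h1 := form_lattice_ideal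
    prime_form_simple.
have h2 := form_lattice_ideal (simple_opp prime_form_simple).
have E g := (ideal_class_eq dm sqd nsd (form_lattice_ideal g) h).
rewrite !mem_cat !inE; split=> /or3P[] H; apply/or3P.
- constructor 1; apply/eqP/(ideal_class_eq dm sqd nsd h h0);
    exact/ideal_equiv_sym/principal_cycle_equiv.
- constructor 2; apply/eqP/(ideal_class_eq dm sqd nsd h h1);
    exact/ideal_equiv_sym/prime_cycle_equiv.
- constructor 3; apply/eqP/(ideal_class_eq dm sqd nsd h h2);
    exact/ideal_equiv_sym/conj_cycle_equiv.
- constructor 1; move/eqP: H => /(ideal_class_eq dm sqd nsd h h0).
  exact: mem_river_closed principal_cycle_closed mem_principal_cycle
      principal_form_simple hf.
- constructor 2; move/eqP: H => /(ideal_class_eq dm sqd nsd h h1).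
  exact: mem_river_closed prime_cycle_closed mem_prime_cycle prime_form_simple hf.
- constructor 3; move/eqP: H => /(ideal_class_eq dm sqd nsd h h2).
  exact: mem_river_closed conj_cycle_closed mem_conj_cycle (simple_opp prime_form_simple)
      hf.
Qed.

Lemma uniq_three_cycles : odd (class_number K) -> uniq (C0 ++ C1 ++ C2).
Proof.
move=> hodd.
have h0 := form_lattice_ideal principal_form_simple; have h1 := form_lattice_ideal
    prime_form_simple.
have h2 := form_lattice_ideal (simple_opp prime_form_simple).
have u0 : uniq C0.
  by apply: (uniq_base_cycle es (ltn0Sn 0) spq nsd principal_form_simple); rewrite //
      oddM op oq.
have u1 : uniq C1 by apply: (uniq_base_cycle es (ltnW p1) sq nsd prime_form_simple).
have u2 : uniq C2 by rewrite map_inj_uniq //; apply: can_inj opp_formK.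
rewrite !cat_uniq u0 u1 u2 /= andbT; apply/andP; split; apply/hasPn => f.
  rewrite mem_cat => /orP[] H; apply/negP => H0.
    apply: prime_not_principal; apply: (ideal_equiv_trans dm sqd nsd (prime_cycle_equiv
        H)).
    exact: ideal_equiv_sym (principal_cycle_equiv H0).
  apply: conj_not_principal; apply: (ideal_equiv_trans dm sqd nsd (conj_cycle_equiv H)).
  exact: ideal_equiv_sym (principal_cycle_equiv H0).
move=> H; apply/negP => H1; apply: (prime_not_conj hodd).
exact: (ideal_equiv_trans dm sqd nsd (prime_cycle_equiv H1) (ideal_equiv_sym
    (conj_cycle_equiv H))).
Qed.

(** The three classes are distinct, and every class contains the lattice of a simple form; a fourth
    class would thus show up as a simple form off the three cycles. *)
Lemma class_number3 : odd (class_number K) ->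
  class_number K = 3%N <-> forall f, simple d%:Z f -> f \in C0 ++ C1 ++ C2.
Proof.
move=> hodd.
have fin : finite_set (ideal_classes O).
  by apply: class_number_finite => h; rewrite h in hodd.
have inX f : simple d%:Z f -> ideal_class O (form_lattice f) \in fset_set (ideal_classes
    O).
  by move=> hf; rewrite in_fset_set // inE; exists (form_lattice f) => //; exact:
      form_lattice_ideal.
pose Y := [fset c in [:: c0; c1; c2]]%fset.
have cY : #|` Y| = 3%N by rewrite card_fseq undup_id // uniq_classes.
have YX : (Y `<=` fset_set (ideal_classes O))%fset.
  apply/fsubsetP => c; rewrite !inE orbF => /or3P[] /eqP ->; apply: inX.
  - exact: principal_form_simple.
  - exact: prime_form_simple.
  - exact: simple_opp prime_form_simple.
split=> [h3 f hf|h].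
  apply/mem_three_cycles => //; have := inX _ hf.
  have <- : Y = fset_set (ideal_classes O).
    by apply/eqP; rewrite eqEfcard YX cY -h3 leqnn.
  by rewrite !inE !orbF.
rewrite /class_number; suff <- : Y = fset_set (ideal_classes O) by [].
apply/eqP; rewrite eqEfsubset YX; apply/fsubsetP => c.
rewrite in_fset_set // inE => -[I hI <-].
have [f hf hIf] := ideal_equiv_simple dm sqd nsd hI.
have -> : ideal_class O I = ideal_class O (form_lattice f).
  by apply/(ideal_class_eq dm sqd nsd hI (form_lattice_ideal hf)).
have /(mem_three_cycles hf) := h f hf.
by rewrite !inE orbF.
Qed.

Lemma sum_three_cycles : 6 * (\sum_(f <- C0 ++ C1 ++ C2) f.1.1) =
  e%:Z * p%:Z * q%:Z * (e%:Z ^+ 2 * (1 + p%:Z ^+ 2 * q%:Z ^+ 2) + 10) +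
  2 * (e%:Z * p%:Z * q%:Z * (e%:Z ^+ 2 * (p%:Z ^+ 2 + q%:Z ^+ 2) + 10)).
Proof.
rewrite !big_cat /= !mulrDr big_map /=.
have -> : \sum_(f <- C1) (opp_form f).1.1 = \sum_(f <- C1) f.1.1.
  by apply: eq_bigr => -[[a b] c] _.
rewrite (sum_base_cycle es (ltn0Sn 0) spq nsd principal_form_simple).
rewrite (sum_base_cycle es (ltnW p1) sq nsd prime_form_simple) PoszM.
by ring.
Qed.

Lemma class_number3_sum : odd (class_number K) ->
  class_number K = 3%N <->
  6 * sigma_sum d =
  e%:R * p%:R * q%:R * (e%:R ^+ 2 * (1 + p%:R ^+ 2 * q%:R ^+ 2) + 10) +
  2 * (e%:R * p%:R * q%:R * (e%:R ^+ 2 * (p%:R ^+ 2 + q%:R ^+ 2) + 10)).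
Proof.
move=> hodd; rewrite (class_number3 hodd).
rewrite -(sum_simple_forms (uniq_three_cycles hodd) three_cycles_simple) (sigma_sumE d).
set X := (X in X = _ <-> _); set Y := (Y in _ = Y <-> _).
have -> : (X = Y) <-> (6 * X = 6 * Y) by lia.
rewrite /Y sum_three_cycles; set Z := (Z in _ = Z <-> _); set W := (W in _ <-> _ = W).
have -> : W = Z%:~R.
  by rewrite /Z /W !(intrD, intrM, rmorphXn) /=.
have -> : 6 * X%:~R = (6 * X)%:~R :> rat by rewrite intrM.
by split=> [-> //|/eqP]; rewrite eqr_int => /eqP.
Qed.

End ThreeCycles.

Theorem theorem4p2 (r n d p : nat)
    (hr : r = 1%N \/ r = 4%N) (hn : (0 < n)%N)
    (hd : d = (n ^ 2 + r)%N) (hsq : squarefree d)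
    (hd8 : (d = 5 %[mod 8])%N)
    (hp : prime p) (hpodd : odd p) (hpn : (p %| n)%N)
    (hr4 : r = 4%N -> n <> p) (hr1 : r = 1%N -> n <> (2 * p)%N) :
  (class_number (quadratic_field d) = 3%N ->
     sigma_sum d =
       if r == 4%N then
         (n%:R ^+ 3 + 11 * n%:R) / 6
         + (n%:R ^+ 3 + n%:R * (p%:R ^+ 4 + 10 * p%:R ^+ 2)) / (3 * p%:R ^+ 2)
       else
         (n%:R ^+ 3 + 14 * n%:R) / 6
         + (n%:R ^+ 3 + n%:R * (4 * p%:R ^+ 4 + 10 * p%:R ^+ 2))
           / (3 * p%:R ^+ 2))
  /\
  (odd (class_number (quadratic_field d)) ->
     sigma_sum d =
       (if r == 4%N then
         (n%:R ^+ 3 + 11 * n%:R) / 6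
         + (n%:R ^+ 3 + n%:R * (p%:R ^+ 4 + 10 * p%:R ^+ 2)) / (3 * p%:R ^+ 2)
       else
         (n%:R ^+ 3 + 14 * n%:R) / 6
         + (n%:R ^+ 3 + n%:R * (4 * p%:R ^+ 4 + 10 * p%:R ^+ 2))
           / (3 * p%:R ^+ 2)) ->
     class_number (quadratic_field d) = 3%N).
Proof.
have p1 := prime_gt1 hp.
have pR0 : p%:R != 0 :> rat by rewrite pnatr_eq0 -lt0n ltnW.
set F := (if _ then _ else _).
(* As 3 is odd, both directions follow from one equivalence for odd class numbers. *)
suff H : odd (class_number (quadratic_field d)) ->
    class_number (quadratic_field d) = 3%N <-> sigma_sum d = F.
  split=> [h3|hodd]; last exact: (H hodd).2.
  by apply/(H _) => //; rewrite h3.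
move=> hodd; have six0 : 6 != 0 :> rat by [].
suff [e [s [q [es oq sq hd' hF]]]] : exists e s q : nat,
    [/\ (e * s = 2)%N, odd q, (s < q)%N, d = ((e * p * q) ^ 2 + s ^ 2)%N &
      6 * F = e%:R * p%:R * q%:R * (e%:R ^+ 2 * (1 + p%:R ^+ 2 * q%:R ^+ 2) + 10) +
        2 * (e%:R * p%:R * q%:R * (e%:R ^+ 2 * (p%:R ^+ 2 + q%:R ^+ 2) + 10))].
  rewrite (class_number3_sum es p1 hpodd oq sq hd' hd8 hsq hodd) -hF.
  by split=> [/(mulfI six0)|->].
have nmod : (n ^ 2 + r = 5 %[mod 8])%N by rewrite -hd.
have [k hk] := dvdnP hpn.
have [t [i [nE hi]]] : exists t i : nat, n = (8 * t + i)%N /\ (i < 8)%N.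
  by exists (n %/ 8)%N, (n %% 8)%N; lia.
(* Modulo 8, [n ^ 2] is 1 if [r = 4], and 4 if [r = 1]. *)
have icases : [\/ r = 4%N /\ odd n | r = 1%N /\ (n %% 4 = 2)%N].
  move: nmod; rewrite nE -mulnn => nmod.
  have hi8 : (i = 0 \/ i = 1 \/ i = 2 \/ i = 3 \/ i = 4 \/ i = 5 \/ i = 6 \/ i = 7)%N.
    by lia.
  by case: hr => hr; rewrite hr in nmod *;
    case: hi8 => [|[|[|[|[|[|[|]]]]]]] hi'; subst i;
    (try by left; lia); (try by right; lia); exfalso; lia.
case: icases => -[hr' n2].
  rewrite /F hr' /=; exists 1%N, 2%N, k.
  have ok : odd k by move: n2; rewrite hk oddM => /andP[].
  (* Being odd and different from 1, [k = n / p] exceeds [s = 2]. *)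
  have k1 : k <> 1%N by move=> k1; apply: (hr4 hr'); rewrite hk k1 mul1n.
  split=> //.
  - by case: k ok k1 {hk} => [|[|[|]]].
  - by rewrite hd hr' hk mul1n mulnC.
  - by rewrite hk natrM; field.
have [j kj] : exists j, k = (2 * j)%N.
  exists (k./2); have : ~~ odd n by lia.
  by rewrite hk oddM hpodd andbT => h; lia.
have oj : odd j.
  apply: contraT => h; have [l hl] : exists l, j = (2 * l)%N by exists j./2; lia.
  by move: n2; rewrite hk kj hl; lia.
(* Here [j = n / (2 p)] is odd, and [n <> 2 p] excludes [j = 1], so it exceeds [s = 1]. *)
rewrite /F hr' /=; exists 2%N, 1%N, j; split => //.
- case: j oj kj => [|[|]] // _ k2; case: (hr1 hr').
  by rewrite hk k2 muln1.
- by rewrite hd hr' hk kj; lia.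
- by rewrite hk kj !natrM; field.
Qed.
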